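(* Let $\varepsilon>0$. The functional $$\mathcal{I}_{\varepsilon}(u) = \int_0^Te^{-\frac{t}{\varepsilon}}\Big(\varepsilon^2\|u_{tt}\|_{L^2(\Omega)}^2+\|\nabla u\|_{L^2(\Omega)}^2+\|u\|_{L^p(\Omega)}^p-2\langle f,u\rangle_{L^2(\Omega)}\Big)\,\mathrm{d}t$$ has a unique minimiser $u^{\varepsilon}_{\tau,h}$ over the space-time finite element space $\mathcal{K}_{\tau,h}$, and this minimiser satisfies $$A(u^{\varepsilon}_{\tau,h},v)+B(u^{\varepsilon}_{\tau,h};v)=f(v)\qquad\text{for all } v\in\mathcal{K}_{\tau,h},$$ with no condition relating the spatial and temporal meshes being required.
   Context: $\Omega\subset\mathbb{R}^d$, $d\in\{1,2,3\}$, is a bounded polygonal/polyhedral domain (an interval if $d=1$), $T>0$ is finite, $I=(0,T]$, and $f\in L^2(0,T;L^2(\Omega))$. The exponent $p$ satisfies $p=0$, $p=2$ or $p>2$; for $p=0$ the term $\|u\|_{L^p(\Omega)}^p$ is omitted and $B=0$. Forms: $A(u,v)=\int_0^Te^{-t/\varepsilon}\big(\varepsilon^2\langle u_{tt},v_{tt}\rangle_{L^2(\Omega)}+\langle\nabla u,\nabla v\rangle_{L^2(\Omega)}\big)\,\mathrm{d}t$, $B(u;v)=\frac p2\int_0^Te^{-t/\varepsilon}\langle|u|^{p-2}u,v\rangle_{L^2(\Omega)}\,\mathrm{d}t$, $f(v)=\int_0^Te^{-t/\varepsilon}\langle f,v\rangle_{L^2(\Omega)}\,\mathrm{d}t$.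 Discrete space: $0=t_0<t_1<\dots<t_{N_t}=T$, $I_i=(t_i,t_{i+1}]$; for $r\in\mathbb{N}$, $r\ge1$, $\mathcal{S}^{\Delta_\tau}(r+2)=\{\phi\in C^2([0,T]):\phi|_{I_j}\in\mathcal{P}_{r+2}(I_j),\ j=0,\dots,N_t-1\}$ and $U_\tau=\{\phi\in\mathcal{S}^{\Delta_\tau}(r+2):\phi(0)=0,\ \phi_t(0)=0\}$. $\mathcal{T}_h$ is a shape-regular mesh of $\Omega$ and $V_h=\{v\in H^1_0(\Omega): v|_K\in\mathcal{P}_s(K)\text{ for all }K\in\mathcal{T}_h\}$, where $\mathcal{P}_s(K)$ denotes polynomials of total degree at most $s$, $s\ge1$. Finally $\mathcal{K}_{\tau,h}=U_\tau\otimes V_h$. *)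

(* Defs.v *)
From HB Require Import structures.
From mathcomp Require Import all_boot all_order all_algebra.
From mathcomp Require Import all_classical all_reals all_analysis.
(* Not imported: its notations clash with those of MathComp-Analysis. *)
From mathcomp Require mpoly.

Set Implicit Arguments.
Unset Strict Implicit.
Unset Printing Implicit Defensive.

Import Order.TTheory GRing.Theory Num.Theory.
Import numFieldNormedType.Exports.

Local Open Scope classical_set_scope.
Local Open Scope ring_scope.

Definition measure_rV_display : measure_display -> measure_display.
Proof. exact. Qed.

(* R^n, seen as row vectors, carries the sigma-algebra generated by the
   coordinates, that is, its Borel sigma-algebra. *)
Section measurable_rV.
Context {d : measure_display} {T : measurableType d}.
Variable n : nat.

Let coord : 'I_n -> 'rV[T]_n -> T := fun i v => v ord0 i.

Let rV_set0 : g_sigma_preimage coord set0.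
Proof. exact: sigma_algebra0. Qed.

Let rV_setC A : g_sigma_preimage coord A -> g_sigma_preimage coord (~` A).
Proof. exact: sigma_algebraC. Qed.

Let rV_bigcup (F : _^nat) : (forall i, g_sigma_preimage coord (F i)) ->
  g_sigma_preimage coord (\bigcup_i (F i)).
Proof. exact: sigma_algebra_bigcup. Qed.

HB.instance Definition _ := @isMeasurable.Build (measure_rV_display d)
  'rV[T]_n (g_sigma_preimage coord) rV_set0 rV_setC rV_bigcup.

Lemma measurable_coord (i : 'I_n) :
  measurable_fun [set: 'rV[T]_n] (fun v : 'rV[T]_n => v ord0 i).
Proof.
move=> _ Y mY; rewrite setTI; apply: sub_sigma_algebra => /=.
rewrite -bigcup_seq/=; exists i => /=; first by rewrite mem_index_enum.
by exists Y => //; rewrite setTI.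
Qed.

Lemma measurable_fun_coordP d1 (T1 : measurableType d1) (f : T1 -> 'rV[T]_n) :
  (forall i, measurable_fun [set: T1] (fun x => f x ord0 i)) ->
  measurable_fun [set: T1] f.
Proof.
move=> mf _ Y mY; rewrite setTI.
have : g_sigma_preimage (fun i => coord i \o f) `<=` measurable.
  apply: smallest_sub; first exact: sigma_algebra_measurable.
  rewrite -bigcup_seq/=; apply: bigcup_sub => i _.
  by move=> A [B mB <-]; exact: mf.
apply; rewrite /g_sigma_preimage.
have -> : \big[setU/set0]_(i < n)
    preimage_set_system [set: T1] (coord i \o f) measurable =
  preimage_set_system [set: T1] f (\big[setU/set0]_(i < n)
    preimage_set_system [set: 'rV[T]_n] (coord i) measurable).
  rewrite (big_morph _ (preimage_set_systemU _ _) (preimage_set_system0 _ _)).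
  by apply: eq_bigr => i _; rewrite -preimage_set_system_comp.
by rewrite g_sigma_preimageE; exists Y => //; rewrite setTI.
Qed.

End measurable_rV.

Section lebesgue_measure_rV.
Context {R : realType}.

Definition consrV n (z : R * 'rV[R]_n) : 'rV[R]_n.+1 :=
  \row_i oapp (fun j => z.2 ord0 j) z.1 (unlift ord0 i).

Definition unconsrV n (v : 'rV[R]_n.+1) : R * 'rV[R]_n :=
  (v ord0 ord0, \row_j v ord0 (lift ord0 j)).

Lemma consrVK n : cancel (@consrV n) (@unconsrV n).
Proof.
move=> [a v]; rewrite /unconsrV /consrV mxE unlift_none/=; congr pair.
by apply/rowP => j; rewrite !mxE liftK.
Qed.

Lemma unconsrVK n : cancel (@unconsrV n) (@consrV n).
Proof.
by move=> v; apply/rowP => i; rewrite mxE/=; case: unliftP => [j ->|->] /=; rewrite ?mxE.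
Qed.

Lemma measurable_consrV n :
  measurable_fun [set: (R * 'rV[R]_n)%type] (@consrV n).
Proof.
apply: measurable_fun_coordP => i.
under eq_fun do rewrite mxE.
case: unliftP => [j|] _ /=; last exact: measurable_fst.
exact: (measurableT_comp (measurable_coord j) measurable_snd).
Qed.

Lemma measurable_unconsrV n :
  measurable_fun [set: 'rV[R]_n.+1] (@unconsrV n).
Proof.
apply/measurable_fun_pairP; split; first exact: measurable_coord.
apply: measurable_fun_coordP => i /=.
by under eq_fun do rewrite mxE; exact: measurable_coord.
Qed.

Section step.
Variables (n : nat) (m : {sigma_finite_measure set 'rV[R]_n -> \bar R}).

Definition lebesgue_step : set 'rV[R]_n.+1 -> \bar R :=
  pushforward (@lebesgue_measure R \x m)%E (@consrV n).

Let mcons : measurable_fun [set: (R * 'rV[R]_n)%type] (@consrV n) :=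
  @measurable_consrV n.

Let step0 : lebesgue_step set0 = 0%E. Proof. exact: measure0. Qed.

Let step_ge0 A : (0 <= lebesgue_step A)%E. Proof. exact: measure_ge0. Qed.

Let step_sigma_additive : semi_sigma_additive lebesgue_step.
Proof. exact: measure_semi_sigma_additive. Qed.

HB.instance Definition _ := isMeasure.Build _ _ _ lebesgue_step
  step0 step_ge0 step_sigma_additive.

Let sigma_finite_step : sigma_finite setT lebesgue_step.
Proof.
have /sigma_finiteP[F [FT ndF Foo]] := sigma_finiteT (@lebesgue_measure R).
have /sigma_finiteP[G [GT ndG Goo]] := sigma_finiteT m.
exists (fun k => @unconsrV n @^-1` (F k `*` G k)).
  rewrite -preimage_bigcup [X in _ @^-1` X](_ : _ = setT) ?preimage_setT//.
  rewrite -subTset => -[x y] _.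
  have [i _ Fx] : (\bigcup_i F i) x by rewrite -FT.
  have [k _ Gy] : (\bigcup_i G i) y by rewrite -GT.
  exists (maxn i k) => //; split.
  - by move: x Fx; exact/subsetPset/ndF/leq_maxl.
  - by move: y Gy; exact/subsetPset/ndG/leq_maxr.
move=> k; have [? ?] := Foo k; have [? ?] := Goo k; split.
  rewrite -[X in measurable X]setTI; apply: measurable_unconsrV => //.
  exact: measurableX.
rewrite /lebesgue_step /pushforward -comp_preimage.
rewrite (_ : _ \o _ = id) ?preimage_id; last first.
  by apply/funext => z /=; rewrite consrVK.
by rewrite product_measure1E// lte_mul_pinfty// ge0_fin_numE.
Qed.

HB.instance Definition _ :=
  Measure_isSigmaFinite.Build _ _ _ lebesgue_step sigma_finite_step.

End step.

Definition dirac_rV0 : set 'rV[R]_0 -> \bar R := @dirac _ 'rV[R]_0 0 R.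
HB.instance Definition _ := Measure.on dirac_rV0.
HB.instance Definition _ := SigmaFiniteMeasure.on dirac_rV0.

(* Lebesgue measure on R^n: the n-fold product of the Lebesgue measure on R. *)
Fixpoint lebesgue_rV n : {sigma_finite_measure set 'rV[R]_n -> \bar R} :=
  match n with
  | 0 => dirac_rV0
  | n.+1 => lebesgue_step (lebesgue_rV n)
  end.
End lebesgue_measure_rV.

Lemma lebesgue_rV_prod (R : realType) n (A : 'I_n -> set R) :
  (forall i, measurable (A i)) ->
  lebesgue_rV n [set v : 'rV[R]_n | forall i, A i (v ord0 i)] =
  (\prod_(i < n) lebesgue_measure (A i))%E.
Proof.
elim: n A => [|n IHn] A mA.
  rewrite big_ord0 /= /dirac_rV0 diracE mem_set//=.
  by case.
rewrite big_ord_recl -IHn//= /lebesgue_step /pushforward.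
set B := [set v : 'rV[R]_n | _].
have mB : measurable B.
  rewrite (_ : B = \bigcap_(i in [set: 'I_n])
      ((fun v : 'rV[R]_n => v ord0 i) @^-1` A (lift ord0 i))); last first.
    by apply/seteqP; split => [v Bv i _|v Bv i]; [exact: Bv|exact: (Bv i)].
  apply: fin_bigcap_measurable => // i _.
  by rewrite -[X in measurable X]setTI; apply: measurable_coord.
rewrite (_ : _ @^-1` _ = A ord0 `*` B); last first.
  apply/seteqP; split => [[x v] /= h|[x v] /= [Ax Bv] i].
    split => [|i]; first by have := h ord0; rewrite mxE unlift_none.
    by have := h (lift ord0 i); rewrite mxE liftK.
  by rewrite mxE; case: unliftP => [j|] -> //=; exact: Bv.
by rewrite product_measure1E//; exact: mA.
Qed.

Section geometry.
Context {R : realType} {d : nat}.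
Implicit Types (Omega K F : set 'rV[R]_d) (x y : 'rV[R]_d).

(* The library's norm on row vectors is the sup norm. *)
Definition enorm x : R := Num.sqrt (\sum_i x ord0 i ^+ 2).

Definition conv_hull n (P : 'I_n -> 'rV[R]_d) : set 'rV[R]_d :=
  [set x | exists a : 'I_n -> R, [/\ forall i, 0 <= a i,
    \sum_i a i = 1 & x = \sum_i a i *: P i]].

Definition affinely_independent n (P : 'I_n -> 'rV[R]_d) : Prop :=
  forall a : 'I_n -> R, \sum_i a i = 0 -> \sum_i a i *: P i = 0 ->
  forall i, a i = 0.

(* The boundary is a finite union of (d-1)-simplices, that is, of points,
   segments or triangles according to whether d = 1, 2 or 3; no Lipschitz
   condition is imposed, so that cracks are allowed. *)
Definition polyhedral_domain Omega : Prop :=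
  [/\ open Omega, connected Omega, Omega !=set0, bounded_set Omega &
    exists (m : nat) (S : 'I_m -> 'I_d -> 'rV[R]_d),
      (forall j, affinely_independent (S j)) /\
      closure Omega `\` Omega = \bigcup_(j in [set: 'I_m]) conv_hull (S j)].

(* The empty set counts as a face. *)
Definition is_face K F : Prop :=
  F `<=` K /\
  forall x y (a : R), K x -> K y -> 0 < a < 1 ->
    F (a *: x + (1 - a) *: y) -> F x /\ F y.

Definition diameter K : R :=
  sup [set r | exists x y, [/\ K x, K y & r = enorm (x - y)]].

Definition indiameter K : R :=
  sup [set r | exists c rho, [/\ 0 < rho,
    [set x | enorm (x - c) <= rho] `<=` K & r = rho *+ 2]].

(* Conforming mesh of Omega made of m closed convex polytopes (in particular,
   possibly, of simplices), with shape-regularity constant sigma. *)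
Definition shape_regular_mesh Omega (sigma : R) m (K : 'I_m -> set 'rV[R]_d) :
    Prop :=
  [/\ forall j, (K j)° !=set0 /\
        exists (n : nat) (P : 'I_n -> 'rV[R]_d), K j = conv_hull P,
      closure Omega = \bigcup_(j in [set: 'I_m]) K j,
      forall j k, j != k -> (K j)° `&` (K k)° = set0,
      forall j k, is_face (K j) (K j `&` K k) &
      forall j, diameter (K j) <= sigma * indiameter (K j)].

End geometry.

Section sobolev.
Context {R : realType} {d : nat}.
Variable Omega : set 'rV[R]_d.
Implicit Types (u v : 'rV[R]_d -> R) (g h : 'rV[R]_d -> 'rV[R]_d).

Local Notation leb := (@lebesgue_rV R d).

(* Functions are representatives of classes modulo equality almost everywhere
   in Omega. *)
Definition L2 v : Prop :=
  measurable_fun Omega v /\ (\int[leb]_(x in Omega) (v x ^+ 2)%:E < +oo)%E.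

Definition L2ip u v : R := \int[leb]_(x in Omega) (u x * v x).

Definition L2ipV g h : R :=
  \int[leb]_(x in Omega) (\sum_i g x ord0 i * h x ord0 i).

Definition partial_deriv (i : 'I_d) v : 'rV[R]_d -> R :=
  fun x => 'D_(delta_mx ord0 i) v x.

Definition smooth v : Prop :=
  forall s : seq 'I_d, let w := foldr partial_deriv v s in
    continuous w /\ forall x i, derivable w x (delta_mx ord0 i).

Definition test_function v : Prop :=
  [/\ smooth v, compact (closure [set x | v x != 0]) &
      closure [set x | v x != 0] `<=` Omega].

Definition is_weak_grad v g : Prop :=
  (forall i, L2 (fun x => g x ord0 i)) /\
  forall phi, test_function phi -> forall i,
    \int[leb]_(x in Omega) (v x * partial_deriv i phi x) =
    - \int[leb]_(x in Omega) (g x ord0 i * phi x).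

(* A representative of the weak gradient, which is unique up to equality almost
   everywhere in Omega; 0 if there is none. *)
Definition grad v : 'rV[R]_d -> 'rV[R]_d :=
  xget (fun=> 0) [set g | is_weak_grad v g].

Definition H1 v : Prop := L2 v /\ exists g, is_weak_grad v g.

Definition H1normsq v : R := L2ip v v + L2ipV (grad v) (grad v).

Definition H10 v : Prop :=
  H1 v /\ forall e : R, 0 < e ->
    exists phi, test_function phi /\ H1normsq (fun x => v x - phi x) < e.

(* L^2(0, T; L^2(Omega)): strongly measurable maps (almost everywhere limits of
   simple functions) of (0, T) into L^2(Omega) with square-integrable norm *)
Definition bochner_L2 (T : R) (f : R -> 'rV[R]_d -> R) : Prop :=
  [/\ forall t, 0 < t < T -> L2 (f t),
      exists s : nat -> R -> 'rV[R]_d -> R,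
        (forall n, exists (m : nat) (A : 'I_m -> set R)
            (g : 'I_m -> 'rV[R]_d -> R),
          [/\ forall k, measurable (A k), forall k, L2 (g k) &
              forall t x, s n t x = \sum_k \1_(A k) t * g k x]) /\
        {ae (@lebesgue_measure R), forall t, 0 < t < T ->
          (fun n => L2ip (fun x => s n t x - f t x) (fun x => s n t x - f t x))
            @ \oo --> (0 : R)} &
      (\int[lebesgue_measure]_(t in `]0%R, T[) (L2ip (f t) (f t))%:E < +oo)%E].

(* |u|_{L^p}^p, the term being omitted when p = 0 *)
Definition Lp_term (p : R) u : R :=
  if p == 0 then 0 else \int[leb]_(x in Omega) (`|u x| `^ p).

End sobolev.

Section spline.
Context {R : realType}.
Implicit Types (phi : R -> R) (A : set R).

Definition diffquot phi (x y : R) : R := (phi y - phi x) / (y - x).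

Definition derivable_within A phi x : Prop :=
  cvg (diffquot phi x y @[y --> within A x^']).

(* one-sided derivative at the endpoints when A is an interval *)
Definition derive_within A phi x : R :=
  lim (diffquot phi x y @[y --> within A x^']).

Definition C2_on A phi : Prop :=
  [/\ forall x, A x -> derivable_within A phi x,
      forall x, A x -> derivable_within A (derive_within A phi) x &
      {within A, continuous (derive_within A (derive_within A phi))}].

Definition time_mesh (T : R) (Nt : nat) (tau : nat -> R) : Prop :=
  [/\ tau 0%N = 0, forall j, (j < Nt)%N -> tau j < tau j.+1 & tau Nt = T].

Definition spline_space (T : R) Nt (tau : nat -> R) (k : nat) phi : Prop :=
  C2_on `[0, T] phi /\
  forall j, (j < Nt)%N -> exists q : {poly R}, (size q <= k.+1)%N /\
    forall t, tau j < t <= tau j.+1 -> phi t = q.[t].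

Definition U_tau (T : R) Nt (tau : nat -> R) (r : nat) phi : Prop :=
  [/\ spline_space T Nt tau r.+2 phi, phi 0 = 0 & derive_within `[0, T] phi 0 = 0].

End spline.

Section fem.
Context {R : realType} {d : nat}.
Variable Omega : set 'rV[R]_d.

Definition V_h m (K : 'I_m -> set 'rV[R]_d) (s : nat) (v : 'rV[R]_d -> R) : Prop :=
  H10 Omega v /\
  forall j, exists p : mpoly.mpoly d R,
    all (fun mu => mpoly.mdeg mu <= s)%N (mpoly.msupp p) /\
    {ae (@lebesgue_rV R d), forall x, K j x -> Omega x ->
      v x = mpoly.meval (fun i => x ord0 i) p}.

Definition tensor_space (T : R) (U : set (R -> R)) (V : set ('rV[R]_d -> R))
    (u : R -> 'rV[R]_d -> R) : Prop :=
  exists (n : nat) (phi : 'I_n -> R -> R) (v : 'I_n -> 'rV[R]_d -> R),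
    [/\ forall k, U (phi k), forall k, V (v k) &
        forall t x, 0 <= t <= T -> Omega x ->
          u t x = \sum_k phi k t * v k x].

Definition K_tau_h (T : R) Nt (tau : nat -> R) (r : nat)
    m (K : 'I_m -> set 'rV[R]_d) (s : nat) : set (R -> 'rV[R]_d -> R) :=
  tensor_space T (U_tau T Nt tau r) (V_h K s).

End fem.

Section forms.
Context {R : realType} {d : nat}.
Variables (Omega : set 'rV[R]_d) (T eps p : R) (f : R -> 'rV[R]_d -> R).
Implicit Types u v : R -> 'rV[R]_d -> R.

Definition dtt u : R -> 'rV[R]_d -> R :=
  fun t x => derive_within `[0, T] (derive_within `[0, T] (u ^~ x)) t.

Definition wint (F : R -> R) : R :=
  \int[lebesgue_measure]_(t in `]0, T[) (expR (- t / eps) * F t).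

Definition wide_functional u : R := wint (fun t =>
  eps ^+ 2 * L2ip Omega (dtt u t) (dtt u t)
  + L2ipV Omega (grad Omega (u t)) (grad Omega (u t))
  + Lp_term Omega p (u t)
  - 2 * L2ip Omega (f t) (u t)).

Definition form_A u v : R := wint (fun t =>
  eps ^+ 2 * L2ip Omega (dtt u t) (dtt v t)
  + L2ipV Omega (grad Omega (u t)) (grad Omega (v t))).

(* The factor p/2 makes form_B vanish when p = 0. *)
Definition form_B u v : R :=
  p / 2 * wint (fun t =>
    L2ip Omega (fun x => `|u t x| `^ (p - 2) * u t x) (v t)).

Definition form_f v : R := wint (fun t => L2ip Omega (f t) (v t)).

End forms.

Definition is_minimiser (R : realType) (X : Type) (V : set X) (J : X -> R) (u : X) :
    Prop :=
  V u /\ forall w, V w -> J u <= J w.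

(* Main.v *)
Require Import Defs.
From mathcomp Require Import all_boot all_order all_algebra.
From mathcomp Require Import all_classical all_reals all_analysis.
From mathcomp Require mpoly.
From mathcomp Require Import measurable_realfun ring lra.

(** On a time interval times a mesh cell, the elements of the discrete space
    are polynomials, so that, functions being identified when they agree almost
    everywhere in space, the space has finite dimension ([K_dependent]). The
    functional is there A(u, u) + P(u) - 2 f(u), where P(u) is the weighted time
    integral of the p-th power of the L^p norm of u.

    The form A is nonnegative, and A(z, z) = 0 forces z to be null
    ([form_A_null]): the second time derivative of z vanishes, and so do the
    initial data imposed by U_tau. The convex term has a subgradient,
    P(u) + b(u, v - u) <= P(v) with b = 2 B ([P_subgradient]), hence the
    functional exceeds its affine support at u by at least A(v - u, v - u). In
    coordinates that are orthonormal for A this is strong convexity on R^n, and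
    minimising sequences converge ([exists_energy_min]). At a minimiser u, the
    subgradient inequality at u + c v bounds the difference quotient of the
    functional, and b(u + c v, v) exceeds b(u, v) by at most a multiple of c
    ([b_increment]), as the elements of the space are bounded functions; letting
    c tend to 0 gives the Euler equation ([euler_lagrange]). Inserted back into
    the support inequality, that equation bounds A(w - u, w - u) by the
    difference of the energies of w and u, whence uniqueness
    ([energy_min_unique]).

    The meshes enter through the finite dimension only, so no relation between
    them is needed.

    The rest makes these forms meaningful for representatives of classes of
    functions. The gradient of a function is a chosen representative of its weak
    gradient; it depends linearly on the function, up to null sets, because weak
    gradients are unique ([weak_grad_unique]), which is the fundamental lemma of
    the calculus of variations ([fundamental_lemma]). The pairing of the load
    with a function of x is merely almost everywhere equal to an integrable
    function of time ([bochner_ae_int]); integrals nevertheless behave linearly,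
    because a lower integral ignores null sets even without measurability
    ([ae_eq_lower_integral]). *)

Set Implicit Arguments.
Unset Strict Implicit.
Unset Printing Implicit Defensive.

Import Order.TTheory GRing.Theory Num.Theory.
Import numFieldNormedType.Exports.

Local Open Scope classical_set_scope.
Local Open Scope ring_scope.

(** * Strongly convex energies on a finite-dimensional space *)

(** Applied at the midpoint of two points, the hypothesis bounds their squared
    distance by the excess of their values over the infimum, so that a
    minimising sequence is Cauchy. The support inequality at its limit, where
    the linear term tends to 0, bounds the value there by the infimum; this
    replaces lower semicontinuity. *)
Lemma strongly_convex_min (R : realType) n (j : 'rV[R]_n -> R)
    (g : 'rV[R]_n -> 'rV[R]_n) :
  (forall c c' : 'rV[R]_n, j c + \sum_i g c ord0 i * (c' ord0 i - c ord0 i)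
     + \sum_i (c' ord0 i - c ord0 i) ^+ 2 <= j c') ->
  exists c, forall c', j c <= j c'.
Proof.
move=> jP.
pose m := inf (range j).
have jlb : has_lbound (range j).
  exists (j 0 - \sum_i (g 0 ord0 i) ^+ 2) => _ [c _ <-].
  apply: le_trans (jP 0 c); rewrite -addrA lerD2l -big_split -sumrN /=.
  apply: ler_sum => i _; rewrite mxE; set x := g _ _ _; set y := c _ _; nra.
have mP c : m <= j c by apply: ge_inf => //; exists c.
have jinf : has_inf (range j) by split => //; exists (j 0), 0.
have exc k : exists c, j c < m + k.+1%:R^-1.
  have k0 : 0 < k.+1%:R^-1 :> R by rewrite invr_gt0 ltr0n.
  by have [_ [c _ <-] ?] := inf_adherent k0 jinf; exists c.
have [s sP] := choice exc.
(* strong convexity at the midpoint *)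
have mid (x y : 'rV[R]_n) : \sum_i (x ord0 i - y ord0 i) ^+ 2 <= 2 * (j x + j y - m - m).
  pose c := \row_i ((x ord0 i + y ord0 i) / 2).
  have := jP c x; have := jP c y; have := mP c.
  have -> : \sum_i (x ord0 i - c ord0 i) ^+ 2 = (\sum_i (x ord0 i - y ord0 i) ^+ 2) / 4.
    rewrite mulr_suml; apply: eq_bigr => i _; rewrite mxE; by field.
  have -> : \sum_i (y ord0 i - c ord0 i) ^+ 2 = (\sum_i (x ord0 i - y ord0 i) ^+ 2) / 4.
    rewrite mulr_suml; apply: eq_bigr => i _; rewrite mxE; by field.
  have -> : \sum_i g c ord0 i * (y ord0 i - c ord0 i) =
     - \sum_i g c ord0 i * (x ord0 i - c ord0 i).
    rewrite -sumrN; apply: eq_bigr => i _; rewrite !mxE; by field.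
  by set u := \sum_i _; set v := \sum_i _; lra.
have close i (e : R) k l : 0 < e -> k.+1%:R^-1 < e ^+ 2 / 4 ->
    l.+1%:R^-1 < e ^+ 2 / 4 -> `|s k ord0 i - s l ord0 i| < e.
  move=> e0 hk hl.
  rewrite -(ltr_pXn2r (n := 2)) ?nnegrE ?(ltW e0)// real_normK ?num_real//.
  apply: (@le_lt_trans _ _ (\sum_i (s k ord0 i - s l ord0 i) ^+ 2)).
    rewrite (bigD1 i)//= lerDl; apply: sumr_ge0 => ? _; exact: sqr_ge0.
  apply: le_lt_trans (mid _ _) _.
  move: (sP k) (sP l) hk hl; set a := k.+1%:R^-1; set b := l.+1%:R^-1; lra.
have scau i : cvgn (fun k => s k ord0 i).
  apply: cauchy_cvg; apply/cauchy_ballP => e e0; rewrite near_map2.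
  have H : \forall k \near \oo, k.+1%:R^-1 < (e ^+ 2 / 4 : R).
    by apply: (near_infty_natSinv_lt (PosNum _)); rewrite divr_gt0 ?exprn_gt0.
  near=> k l; rewrite /= /ball /=; apply: close => //; by [near: k | near: l].
exists (\row_i limn (fun k => s k ord0 i)) => c'; apply: le_trans (mP c').
set c := \row_i _.
have h1 : (fun k => j c + \sum_i g c ord0 i * (s k ord0 i - c ord0 i)) @ \oo
   --> j c + \sum_i g c ord0 i * (c ord0 i - c ord0 i).
  apply: cvgD; first exact: cvg_cst.
  apply: cvg_big => [|i _]; first exact: add_continuous.
  apply: cvgM; first exact: cvg_cst.
  apply: cvgB; last exact: cvg_cst.
  by rewrite mxE; exact: scau.
have h2 : (fun k => m + k.+1%:R^-1) @ \oo --> m + 0.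
  apply: cvgD; first exact: cvg_cst.
  exact: cvg_harmonic.
have h : j c + \sum_i g c ord0 i * (c ord0 i - c ord0 i) <= m + 0.
  apply: (ler_cvg_to h1 h2); near=> k.
  apply: le_trans (ltW (sP k)).
  apply: le_trans (jP c (s k)); rewrite lerDl.
  apply: sumr_ge0 => ? _; exact: sqr_ge0.
move: h; rewrite addr0 big1 ?addr0// => i _; rewrite subrr mulr0//.
Unshelve. all: by end_near.
Qed.

Section abstract.
Variables (R : realType) (E : lmodType R) (K : set E).
Variables (a b : E -> E -> R) (l P : E -> R).
Hypothesis K0 : K 0.
Hypothesis KD : forall c u v, K u -> K v -> K (c *: u + v).
Hypothesis asym : forall u v, a u v = a v u.
Hypothesis alin : forall c u v w, K u -> K v -> K w ->
  a (c *: u + v) w = c * a u w + a v w.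
Hypothesis blin : forall c u v w, K u -> K v -> K w ->
  b w (c *: u + v) = c * b w u + b w v.
Hypothesis llin : forall c u v, K u -> K v -> l (c *: u + v) = c * l u + l v.
Hypothesis a_ge0 : forall u, K u -> 0 <= a u u.
Hypothesis Psub : forall u v, K u -> K v -> P u + b u (v - u) <= P v.

Definition energy u := a u u + P u - 2 * l u.

Lemma subspaceZ c u : K u -> K (c *: u).
Proof. by move=> Ku; rewrite -[X in K X]addr0; exact: KD. Qed.

Lemma subspaceD u v : K u -> K v -> K (u + v).
Proof. by move=> Ku Kv; rewrite -[u]scale1r; exact: KD. Qed.

Lemma subspaceB u v : K u -> K v -> K (u - v).
Proof. by move=> Ku Kv; rewrite addrC -scaleN1r; exact: KD. Qed.

Lemma subspace_sum n (e : 'I_n -> E) (c : 'I_n -> R) :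
  (forall i, K (e i)) -> K (\sum_i c i *: e i).
Proof.
move=> Ke; elim/big_rec : _ => [|i x _ Kx]; [exact: K0 | exact: KD].
Qed.

Lemma a_zero w : K w -> a 0 w = 0.
Proof.
by move=> Kw; have := alin 1 K0 K0 Kw; rewrite scale1r addr0 mul1r; lra.
Qed.

Lemma b_zero w : K w -> b w 0 = 0.
Proof.
by move=> Kw; have := blin 1 K0 K0 Kw; rewrite scale1r addr0 mul1r; lra.
Qed.

Lemma l_zero : l 0 = 0.
Proof. by have := llin 1 K0 K0; rewrite scale1r addr0 mul1r; lra. Qed.

Lemma a_sum n (e : 'I_n -> E) (c : 'I_n -> R) w : (forall i, K (e i)) -> K w ->
  a (\sum_i c i *: e i) w = \sum_i c i * a (e i) w.
Proof.
move=> Ke Kw.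
pose Q x y := K x /\ a x w = y.
suff [] : Q (\sum_i c i *: e i) (\sum_i c i * a (e i) w) by [].
elim/big_rec2 : _ => [|i y x _ [Kx <-]]; first by split; [exact: K0 | exact: a_zero].
by split; [exact: KD | rewrite alin].
Qed.

Lemma b_sum n (e : 'I_n -> E) (c : 'I_n -> R) w : (forall i, K (e i)) -> K w ->
  b w (\sum_i c i *: e i) = \sum_i c i * b w (e i).
Proof.
move=> Ke Kw.
pose Q x y := K x /\ b w x = y.
suff [] : Q (\sum_i c i *: e i) (\sum_i c i * b w (e i)) by [].
elim/big_rec2 : _ => [|i y x _ [Kx <-]]; first by split; [exact: K0 | exact: b_zero].
by split; [exact: KD | rewrite blin].
Qed.

Lemma l_sum n (e : 'I_n -> E) (c : 'I_n -> R) : (forall i, K (e i)) ->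
  l (\sum_i c i *: e i) = \sum_i c i * l (e i).
Proof.
move=> Ke.
pose Q x y := K x /\ l x = y.
suff [] : Q (\sum_i c i *: e i) (\sum_i c i * l (e i)) by [].
elim/big_rec2 : _ => [|i y x _ [Kx <-]]; first by split; [exact: K0 | exact: l_zero].
by split; [exact: KD | rewrite llin].
Qed.

(** Exact for the quadratic part, whose expansion at u yields the last term. *)
Lemma energy_subgrad u v : K u -> K v ->
  energy u + (2 * a u (v - u) + b u (v - u) - 2 * l (v - u)) + a (v - u) (v - u)
  <= energy v.
Proof.
move=> Ku Kv.
have Kd := subspaceB Kv Ku.
have := Psub Ku Kv.
have -> : energy v = a (1 *: (v - u) + u) v + P v - 2 * l (1 *: (v - u) + u).
  by rewrite scale1r subrK.
rewrite /energy alin// llin// (asym _ v) (asym _ v).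
have -> : a v (v - u) = a (1 *: (v - u) + u) (v - u) by rewrite scale1r subrK.
have -> : a v u = a (1 *: (v - u) + u) u by rewrite scale1r subrK.
rewrite !alin// (asym (v - u) u); lra.
Qed.

Definition orthonormal n (e : 'I_n -> E) :=
  (forall i, K (e i)) /\ forall i j, a (e i) (e j) = (i == j)%:R.

(* Elements of E stand for classes modulo the null vectors of a: the dimension
   is bounded modulo these, and l and b have to ignore them. *)
Variable N : nat.
Hypothesis findim : forall e : 'I_N -> E, (forall i, K (e i)) ->
  exists c : 'I_N -> R, (exists i, c i != 0) /\
    a (\sum_i c i *: e i) (\sum_i c i *: e i) = 0.
Hypothesis null : forall z, K z -> a z z = 0 ->
  l z = 0 /\ forall u, K u -> b u z = 0.

Lemma orthonormal_sum n (e : 'I_n -> E) (c d : 'I_n -> R) : orthonormal e ->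
  a (\sum_i c i *: e i) (\sum_i d i *: e i) = \sum_i c i * d i.
Proof.
move=> [Ke eo]; rewrite a_sum//; last exact: subspace_sum.
apply: eq_bigr => i _; rewrite asym a_sum//.
rewrite (bigD1 i)//= eo eqxx mulr1 big1 ?addr0// => k ki.
by rewrite eo (negbTE ki) mulr0.
Qed.

(** An orthonormal family is independent modulo null vectors, so its length is
    less than N. When the length is maximal, the remainder of u after projection
    is null, since it could otherwise be normalised and appended. *)
Lemma orthonormal_max : exists n (e : 'I_n -> E), orthonormal e /\
  forall u, K u -> a (u - \sum_i a u (e i) *: e i) (u - \sum_i a u (e i) *: e i) = 0.
Proof.
pose ON n := exists e : 'I_n -> E, orthonormal e.
have NN : ~ ON N.
  move=> [e eo]; have [c [[i ci]]] := findim eo.1.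
  rewrite orthonormal_sum// => /eqP; rewrite psumr_eq0; last first.
    by move=> j _; rewrite -expr2 sqr_ge0.
  by move=> /allP /(_ i); rewrite mem_index_enum mulf_eq0 orbb (negbTE ci) => /(_ isT).
have [n [ONn ONn1]] : exists n, ON n /\ ~ ON n.+1.
  apply: contrapT => h; apply: NN; elim: N => [|n IH].
    have e0 : 'I_0 -> E by case.
    by exists e0; split => -[].
  by apply: contrapT => hn; apply: h; exists n.
have [e eo] := ONn; exists n, e; split=> // u Ku.
set z := u - _; apply: contrapT => /eqP zz0; apply: ONn1.
have [Ke eij] := eo.
have Kz : K z by apply: subspaceB => //; exact: subspace_sum.
have zz : 0 < a z z by rewrite lt_def zz0 a_ge0.
have ze i : a z (e i) = 0.
  have := alin (-1) (subspace_sum (fun i => a u (e i)) Ke) Ku (Ke i).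
  rewrite scaleN1r addrC -/z => ->.
  rewrite a_sum// (bigD1 i)//= eij eqxx mulr1 big1 ?addr0; first by rewrite mulN1r addNr.
  by move=> j ji; rewrite eij (negbTE ji) mulr0.
pose s := (Num.sqrt (a z z))^-1.
have azs w y : K w -> K y -> a (s *: w) y = s * a w y.
  by move=> Kw Ky; rewrite -[s *: w]addr0 alin// a_zero// addr0.
have Ks : K (s *: z) by exact: subspaceZ.
exists (fun i => oapp e (s *: z) (unlift ord_max i)); split.
  by move=> i; case: unliftP => [j|] _ /=.
move=> i j; case: (unliftP ord_max i) => [i' ->|->] /=;
  case: (unliftP ord_max j) => [j' ->|->] /=.
- by rewrite eij (inj_eq lift_inj).
- by rewrite asym azs// ze mulr0 eq_sym (negbTE (neq_lift _ _)).
- by rewrite azs// ze mulr0 (negbTE (neq_lift _ _)).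
- rewrite azs// asym azs// eqxx mulrA -expr2 exprVn sqr_sqrtr ?ltW// mulVf//.
Qed.

(** This disposes of the component of a competitor that the coordinates do not
    see. *)
Lemma energy_null u z : K u -> K z -> a z z = 0 -> energy (u - z) <= energy u.
Proof.
move=> Ku Kz z0.
have Kuz := subspaceB Ku Kz.
have [lz bz] := null Kz z0.
have := energy_subgrad Kuz Ku; rewrite subKr z0 lz bz// addr0 mulr0 subr0.
suff -> : a (u - z) z = 0 by lra.
(* otherwise a (w + t z) (w + t z) = a w w + 2 t (a w z), z being null, would
   be -1 for the following t *)
apply: contrapT => /eqP w0; set w := u - z in w0 Kuz *.
pose t := - (1 + a w w) / (2 * a w z).
have := a_ge0 (KD t Kz Kuz).
rewrite alin//; last exact: KD.
rewrite asym alin// [a w (_ + _)]asym alin// z0 (asym z w) mulr0 add0r.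
have : t * a w z = - (1 + a w w) / 2 by rewrite /t; field.
by set q := t * _; lra.
Qed.

(** In the coordinates of a maximal orthonormal family the quadratic part is the
    squared Euclidean norm, so the energy is strongly convex on R^n. *)
Lemma exists_energy_min : exists u, K u /\ forall w, K w -> energy u <= energy w.
Proof.
have [n [e [eo eP]]] := orthonormal_max.
have [Ke _] := eo.
pose S (c : 'rV[R]_n) := \sum_i c ord0 i *: e i.
have KS c : K (S c) by exact: subspace_sum.
pose g (c : 'rV[R]_n) : 'rV[R]_n :=
  \row_i (2 * a (S c) (e i) + b (S c) (e i) - 2 * l (e i)).
have SB c c' : S c' - S c = \sum_i (c' ord0 i - c ord0 i) *: e i.
  by rewrite /S -sumrB; apply: eq_bigr => i _; rewrite scalerBl.
have [|c cP] := @strongly_convex_min R n (energy \o S) g.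
  move=> c c' /=; apply: le_trans (energy_subgrad (KS c) (KS c')).
  rewrite SB orthonormal_sum// asym a_sum// b_sum// l_sum//.
  rewrite le_eqVlt; apply/orP; left; apply/eqP; congr (_ + _ + _).
  rewrite !mulr_sumr -big_split -sumrB /=; apply: eq_bigr => i _.
  by rewrite mxE (asym (e i)); ring.
exists (S c); split => // w Kw.
pose d : 'rV[R]_n := \row_i a w (e i).
have Sd : S d = \sum_i a w (e i) *: e i by apply: eq_bigr => i _; rewrite mxE.
apply: le_trans (cP d) _ => /=.
have -> : S d = w - (w - S d) by rewrite subKr.
by apply: energy_null => //; [exact: subspaceB | rewrite Sd; exact: eP].
Qed.

(** The subgradient inequality is used at u + d v, not at u: compared with the
    minimality of u, it bounds b (u + d v) v from below, and the bound on the
    increment of b then allows d to tend to 0. This yields an inequality for v,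
    and the opposite one for - v. *)
Lemma euler_lagrange u : K u -> (forall w, K w -> energy u <= energy w) ->
  (forall v, K v -> exists C, forall d, 0 < d <= 1 ->
     b (u + d *: v) v <= b u v + C * d) ->
  forall v, K v -> 2 * a u v + b u v = 2 * l v.
Proof.
move=> Ku umin bcont.
suff H v : K v -> 0 <= 2 * a u v + b u v - 2 * l v.
  move=> v Kv; have := H _ Kv; have := H _ (subspaceZ (-1) Kv).
  have -> : b u (-1 *: v) = - b u v.
    by have := blin (-1) Kv K0 Ku; rewrite b_zero// !addr0 mulN1r.
  have -> : l (-1 *: v) = - l v.
    by have := llin (-1) Kv K0; rewrite l_zero// !addr0 mulN1r.
  have -> : a u (-1 *: v) = - a u v.
    by have := alin (-1) Kv K0 Ku; rewrite a_zero// !addr0 mulN1r (asym u v) asym.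
  lra.
move=> Kv; have [C CP] := bcont _ Kv.
set X := 2 * a u v + b u v - 2 * l v; rewrite leNgt; apply/negP => X0.
have key d : 0 < d <= 1 -> 0 <= X + (2 * a v v + C) * d.
  move=> /andP[d0 d1].
  have Kd : K (u + d *: v) by apply: subspaceD => //; exact: subspaceZ.
  have Kmd : K ((- d) *: v) by exact: subspaceZ.
  have := energy_subgrad Kd Ku.
  have -> : u - (u + d *: v) = (- d) *: v by rewrite opprD addrA subrr add0r scaleNr.
  have := umin _ Kd.
  have := CP d; rewrite d0 d1 => /(_ isT).
  have -> : b (u + d *: v) (- d *: v) = - d * b (u + d *: v) v.
    by have := blin (- d) Kv K0 Kd; rewrite b_zero// !addr0.
  have -> : l (- d *: v) = - d * l v.
    by have := llin (- d) Kv K0; rewrite l_zero// !addr0.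
  have az c w : K w -> a (c *: v) w = c * a v w.
    by move=> Kw; have := alin c Kv K0 Kw; rewrite a_zero// !addr0.
  rewrite [a _ (- d *: v)]asym !az// asym [a v (_ *: _)]asym az//.
  have -> : a (u + d *: v) v = a u v + d * a v v.
    by rewrite addrC alin// addrC.
  rewrite /X; set B := b (_ + _) _; move=> h1 h2 h3.
  have h4 : 0 <= d * (2 * a u v + B - 2 * l v + 2 * a v v * d - d * a v v) by nra.
  have : 0 <= 2 * a u v + B - 2 * l v + 2 * a v v * d - d * a v v.
    by rewrite -(pmulr_rge0 _ d0).
  have := a_ge0 Kv; nra.
(* small enough for D * d to be at most - X / 2 *)
pose D := 2 * a v v + C.
pose d := Num.min 1 (- X / (2 * (`|D| + 1))).
have D1 : 0 < 2 * (`|D| + 1) by rewrite mulr_gt0// ltr_wpDl.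
have d0 : 0 < d by rewrite /d lt_min ltr01/= divr_gt0// oppr_gt0.
have d1 : d <= 1 by rewrite /d ge_min lexx.
have d2 : d * (2 * (`|D| + 1)) <= - X.
  by rewrite -ler_pdivlMr// /d ge_min lexx orbT.
have := key d; rewrite d0 d1 => /(_ isT); rewrite -/D.
have := ler_norm D; have := normr_ge0 D; nra.
Qed.

Lemma energy_min_unique u w : K u -> K w ->
  (forall v, K v -> 2 * a u v + b u v = 2 * l v) ->
  (forall v, K v -> energy w <= energy v) -> a (w - u) (w - u) = 0.
Proof.
move=> Ku Kw EL wmin.
have Kd := subspaceB Kw Ku.
have := energy_subgrad Ku Kw; have := wmin _ Ku; have := EL _ Kd.
by have := a_ge0 Kd; lra.
Qed.

End abstract.

(** * The power nonlinearity *)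

Section power.
Variable R : realType.
Implicit Types p q x y M : R.

(** Young's inequality for y and x^(q - 1), with the conjugate exponents q and
    q / (q - 1). *)
Lemma powR_tangent q x y : 1 <= q -> 0 <= x -> 0 <= y ->
  x `^ q + q * x `^ (q - 1) * (y - x) <= y `^ q.
Proof.
move=> q1 x0 y0.
have [->|qn1] := eqVneq q 1; first by rewrite !powRr1// subrr powRr0; lra.
have {qn1}q1 : 1 < q by rewrite lt_def qn1.
have q0 : 0 < q by lra.
have xq : x `^ (q - 1) * x = x `^ q.
  by rewrite -{2}(powRr1 x0) -powRD ?subrK// gt_eqF//.
pose q' := q / (q - 1).
have q'0 : 0 < q' by rewrite divr_gt0; lra.
have := @conjugate_powR R y (x `^ (q - 1)) q q' y0 (powR_ge0 _ _) q0 q'0.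
rewrite -powRrM.
have -> : (q - 1) * q' = q by rewrite /q'; field; lra.
have -> : q^-1 + q'^-1 = 1 by rewrite /q'; field; lra.
move=> /(_ erefl) h.
have {h} : q * (y * x `^ (q - 1)) <= q * (y `^ q / q + x `^ q / q').
  by rewrite ler_pM2l.
have -> : q * (y `^ q / q + x `^ q / q') = y `^ q + (q - 1) * x `^ q.
  by rewrite /q'; field; lra.
rewrite -xq; set z := _ `^ (q - 1); lra.
Qed.

(** [p * psi p x] is the derivative at x of the p-th power of the absolute
    value, for p at least 2. *)
Definition psi p x := `|x| `^ (p - 2) * x.

Lemma psiM p x : 2 <= p -> psi p x * x = `|x| `^ p.
Proof.
move=> p2; rewrite /psi -mulrA -expr2 -[x ^+ 2]real_normK ?num_real//.
rewrite -powR_mulrn// -powRD ?subrK//; apply/implyP => /eqP; lra.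
Qed.

Lemma psi_pos p x : 2 <= p -> 0 <= x -> psi p x = x `^ (p - 1).
Proof.
move=> p2 x0; rewrite /psi ger0_norm// -{2}(powRr1 x0) -powRD.
  by congr (_ `^ _); lra.
by apply/implyP => /eqP; lra.
Qed.

Lemma psiN p x : psi p (- x) = - psi p x.
Proof. by rewrite /psi normrN mulrN. Qed.

Lemma norm_psi p x : 2 <= p -> `|psi p x| = `|x| `^ (p - 1).
Proof.
move=> p2; rewrite -psi_pos// /psi normrM normr_id (ger0_norm (powR_ge0 _ _))//.
Qed.

(** Reduces to the tangent inequality at the absolute values of x and y. *)
Lemma psi_subgradient p x y : 2 <= p ->
  `|x| `^ p + p * (psi p x * (y - x)) <= `|y| `^ p.
Proof.
move=> p2; apply: le_trans (powR_tangent _ (normr_ge0 x) (normr_ge0 y)); last by lra.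
rewrite lerD2l -mulrA ler_pM2l; last by lra.
rewrite !mulrBr psiM//.
have -> : `|x| `^ (p - 1) * `|x| = `|x| `^ p.
  rewrite -(psiM x p2) -(psi_pos p2 (normr_ge0 x)) /psi normr_id.
  by rewrite -!mulrA -!expr2 real_normK ?num_real.
rewrite lerD2r -norm_psi// -normrM; exact: ler_norm.
Qed.

(** For arguments of the same sign, this is the tangent inequality for the
    exponent p - 1; for opposite signs, both are compared with 0. *)
Lemma psi_lipschitz p M x y : 2 <= p -> `|x| <= M -> `|y| <= M -> y <= x ->
  psi p x - psi p y <= (p - 1) * M `^ (p - 2) * (x - y).
Proof.
move=> p2.
have pos u v : 0 <= v -> v <= u -> u <= M ->
    psi p u - psi p v <= (p - 1) * M `^ (p - 2) * (u - v).
  move=> v0 vu uM; have u0 := le_trans v0 vu.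
  rewrite !psi_pos//.
  have := @powR_tangent (p - 1) u v; rewrite u0 v0.
  have -> : p - 1 - 1 = p - 2 by ring.
  move=> /(_ ltac:(lra) isT isT).
  have : u `^ (p - 2) <= M `^ (p - 2).
    by rewrite ge0_ler_powR// ?nnegrE//; lra.
  set A := _ `^ (p - 2); set B := _ `^ (p - 2); set C := u `^ _; set D := v `^ _.
  move=> AB h.
  have : 0 <= (p - 1) * (B - A) * (u - v) by rewrite !mulr_ge0//; lra.
  lra.
move=> xM yM yx; have M0 : 0 <= M by apply: le_trans xM.
move: xM yM; rewrite !ler_norml => /andP[xM1 xM2] /andP[yM1 yM2].
have [y0|y0] := leP 0 y; first exact: pos.
have [x0|x0] := leP x 0.
  have := @pos (- y) (- x); rewrite !psiN; have -> : - y - - x = x - y by ring.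
  by move=> h; apply: le_trans (h _ _ _); lra.
have hx := @pos x 0 (lexx _) (ltW x0) xM2.
have hy := @pos (- y) 0 (lexx _) ltac:(lra) ltac:(lra).
have psi0 : psi p 0 = 0 by rewrite /psi mulr0.
move: hx hy; rewrite psiN psi0 !subr0 => hx hy; lra.
Qed.

(** The one-sided bound that the Euler equation requires, with a constant
    independent of x, y and d. *)
Lemma psi_increment p M x y d : 2 <= p -> `|x| <= M -> `|y| <= M -> 0 < d <= 1 ->
  psi p (x + d * y) * y <= psi p x * y + (p - 1) * (2 * M) `^ (p - 2) * M ^+ 2 * d.
Proof.
move=> p2 xM yM /andP[d0 d1].
have M0 : 0 <= M by apply: le_trans xM.
have xM2 : `|x| <= 2 * M by lra.
have xyM : `|x + d * y| <= 2 * M.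
  apply: le_trans (ler_normD _ _) _; rewrite normrM gtr0_norm//.
  have := normr_ge0 y; nra.
have yM2 : y ^+ 2 <= M ^+ 2 by rewrite -[y ^+ 2]real_normK ?num_real// lerXn2r ?nnegrE.
set L := (p - 1) * (2 * M) `^ (p - 2).
have L0 : 0 <= L by rewrite mulr_ge0 ?powR_ge0//; lra.
have h : 0 <= L * (M ^+ 2 - y ^+ 2) * d.
  by apply: mulr_ge0; [apply: mulr_ge0 => //; rewrite subr_ge0 | exact: ltW].
have [y0|y0] := leP 0 y.
  have := @psi_lipschitz p (2 * M) (x + d * y) x p2 xyM xM2.
  rewrite lerDl mulr_ge0 ?(ltW d0)// => /(_ isT); rewrite -/L => hh.
  have : (psi p (x + d * y) - psi p x) * y <= L * (x + d * y - x) * y by rewrite ler_wpM2r.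
  nra.
have := @psi_lipschitz p (2 * M) x (x + d * y) p2 xM2 xyM.
rewrite gerDl nmulr_lle0// (ltW d0) => /(_ isT); rewrite -/L => hh.
have : (psi p x - psi p (x + d * y)) * - y <= L * (x - (x + d * y)) * - y.
  by rewrite ler_wpM2r// oppr_ge0 ltW.
nra.
Qed.

End power.

(** * One-sided derivatives on a segment *)

Section one_sided.
Variables (R : realType) (T : R).
Hypothesis T0 : 0 < T.
Local Notation A := (`[0, T]%classic : set R).
Implicit Types (phi psi : R -> R) (x l c : R).

(** The relational form of [derive_within], whose value is arbitrary where the
    difference quotient has no limit: derivatives are computed as limits, and
    only then identified by [is_derive_withinE]. *)
Definition is_derive_within phi x l := diffquot phi x y @[y --> within A x^'] --> l.

(** No point of the segment is isolated in it, since T > 0; this makes the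
    limits of difference quotients unique. *)
Lemma within_seg_proper x : A x -> ProperFilter (within A x^').
Proof.
rewrite /= in_itv/= => /andP[x0 xT]; apply: Build_ProperFilter_ex => S.
rewrite /within /= /dnbhs /within /= => /nbhs_ballP[e /= e0 eS].
have [xT'|xT'] := ltP x T.
- exists (x + Num.min (e / 2) (T - x)).
  have m0 : 0 < Num.min (e / 2) (T - x) by rewrite lt_min; apply/andP; split; lra.
  have m1 : Num.min (e / 2) (T - x) <= e / 2 by rewrite ge_min lexx.
  have m2 : Num.min (e / 2) (T - x) <= T - x by rewrite ge_min lexx orbT.
  move: m0 m1 m2; set m := Num.min _ _ => m0 m1 m2.
  apply: eS; last by rewrite in_itv/=; apply/andP; split; lra.
    rewrite /ball /= opprD addrA subrr add0r normrN gtr0_norm//; lra.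
  by apply/eqP; lra.
- exists (x - Num.min (e / 2) T).
  have m0 : 0 < Num.min (e / 2) T by rewrite lt_min T0 andbT; lra.
  have m1 : Num.min (e / 2) T <= e / 2 by rewrite ge_min lexx.
  have m2 : Num.min (e / 2) T <= T by rewrite ge_min lexx orbT.
  move: m0 m1 m2; set m := Num.min _ _ => m0 m1 m2.
  apply: eS; last by rewrite in_itv/=; apply/andP; split; lra.
    rewrite /ball /= subKr gtr0_norm//; lra.
  by apply/eqP; lra.
Qed.

Lemma is_derive_withinE phi x l : A x -> is_derive_within phi x l -> derive_within A phi x = l.
Proof.
by move=> Ax h; have := within_seg_proper Ax => pf; apply: cvg_lim.
Qed.

Lemma eq_is_derive_within phi psi x l : A x -> (forall y, A y -> phi y = psi y) ->
  is_derive_within phi x l -> is_derive_within psi x l.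
Proof.
move=> Ax e h; apply: cvg_trans h; apply: near_eq_cvg.
rewrite near_withinE; near=> y => Ay; rewrite /diffquot !e//.
Unshelve. all: by end_near.
Qed.

Lemma is_derive_within_cst c x : is_derive_within (cst c) x 0.
Proof.
rewrite /is_derive_within (_ : diffquot _ _ = cst 0); first exact: cvg_cst.
by apply/funext => y; rewrite /diffquot subrr mul0r.
Qed.

Lemma is_derive_withinD phi psi x l l' : is_derive_within phi x l -> is_derive_within psi x l' ->
  is_derive_within (fun t => phi t + psi t) x (l + l').
Proof.
move=> h h'; rewrite /is_derive_within.
rewrite (_ : diffquot _ _ = fun y => diffquot phi x y + diffquot psi x y); first exact: cvgD.
by apply/funext => y; rewrite /diffquot; ring.
Qed.

Lemma is_derive_withinZ phi x l c : is_derive_within phi x l ->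
  is_derive_within (fun t => phi t * c) x (l * c).
Proof.
move=> h; rewrite /is_derive_within.
rewrite (_ : diffquot _ _ = fun y => diffquot phi x y * c).
  by apply: cvgM => //; exact: cvg_cst.
by apply/funext => y; rewrite /diffquot; ring.
Qed.

Lemma is_derive_within_sum n (phi : 'I_n -> R -> R) x (l c : 'I_n -> R) :
  (forall k, is_derive_within (phi k) x (l k)) ->
  is_derive_within (fun t => \sum_k phi k t * c k) x (\sum_k l k * c k).
Proof.
move=> h; elim: (index_enum _) => [|i r IH].
  by rewrite big_nil; under eq_fun do rewrite big_nil; exact: is_derive_within_cst.
rewrite big_cons; under eq_fun do rewrite big_cons.
by apply: is_derive_withinD => //; exact: is_derive_withinZ.
Qed.

Lemma is_derive_within_cvg phi x l : A x -> is_derive_within phi x l ->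
  phi @ within A (nbhs x) --> phi x.
Proof.
move=> Ax h.
have h1 : (fun y => phi x + diffquot phi x y * (y - x)) @ within A x^' --> phi x.
  rewrite -[X in _ --> X]addr0 -[X in _ --> _ + X](mulr0 l); apply: cvgD; first exact: cvg_cst.
  apply: cvgM; first exact: h.
  rewrite -(subrr x); apply: cvgB; last exact: cvg_cst.
  move=> S /= /nbhs_ballP[e e0 eS]; rewrite /within /= /dnbhs /within /=.
  by apply/nbhs_ballP; exists e => //= y /eS.
move=> S nS.
have : \forall y \near within A x^', S (phi x + diffquot phi x y * (y - x)).
  exact: h1 _ nS.
rewrite !near_withinE => H.
change (\forall y \near x, A y -> S (phi y)); apply: filterS H => y hy Ay.
have [->|yx] := eqVneq y x; first exact: nbhs_singleton.
have := hy yx Ay; rewrite /diffquot divfK ?subr_eq0//.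
by rewrite addrC subrK.
Qed.

Lemma is_derive_within_continuous phi psi : (forall x, A x -> is_derive_within phi x (psi x)) ->
  {within A, continuous phi}.
Proof.
by move=> h; apply/subspace_continuousP => x Ax; exact: is_derive_within_cvg (h _ Ax).
Qed.

(** Gives access to the mean value theorem. *)
Lemma is_derive_within_itv phi x l : 0 < x < T -> is_derive_within phi x l -> is_derive x 1 phi l.
Proof.
move=> /andP[x0 xT] h.
have shift : (fun y : R => y *: (1 : R) + x) @ 0^' --> within A x^'.
  move=> S HS.
  have {}HS : \forall y \near x, y != x -> A y -> S y by [].
  have xA : \forall y \near x, 0 < y < T.
    near=> y; apply/andP; split; near: y; [exact: lt_nbhsr | exact: lt_nbhsl].
  have {}HS : \forall y \near x, y != x -> S y.
    apply: filterS2 HS xA => y hy /andP[y0 yT] yx; apply: hy => //=.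
    by rewrite in_itv/= !ltW.
  have /nbhs_ballP[e e0 eS] := HS; apply/nbhs_ballP; exists e => // y.
  rewrite /ball /= sub0r normrN => ye y0; apply: eS.
    by rewrite /ball /= [_ *: _]mulr1 opprD addrCA subrr addr0 normrN.
  by rewrite [_ *: _]mulr1 -subr_eq0 addrK.
have h' : (fun y => y^-1 *: (phi (y *: 1 + x) - phi x)) @ 0^' --> l.
  rewrite (_ : (fun y => _) = diffquot phi x \o (fun y => y *: 1 + x)).
    exact: cvg_comp shift h.
  apply/funext => y /=; rewrite /diffquot addrK [_ *: 1]mulr1 mulrC; congr (_ * _).
split; first by apply/cvg_ex; exists l; exact: h'.
exact: cvg_lim h'.
Unshelve. all: by end_near.
Qed.

Lemma derive_within0_cst phi psi : (forall x, A x -> is_derive_within phi x (psi x)) ->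
  (forall x, 0 < x < T -> psi x = 0) -> forall x, A x -> phi x = phi 0.
Proof.
move=> h h0 x Ax.
have cphi := is_derive_within_continuous h.
have := Ax; rewrite /= in_itv/= => /andP[x0 xT].
have [->//|xn0] := eqVneq x 0.
have {xn0}x0' : 0 < x by rewrite lt_def xn0.
have [y | | y] := @MVT R phi psi 0 x x0'.
- rewrite in_itv/= => /andP[y0 yx]; apply: is_derive_within_itv.
    by rewrite y0 (lt_le_trans yx).
  by apply: h; rewrite /= in_itv/=; apply/andP; split; lra.
- apply: continuous_subspaceW cphi => y /=; rewrite !in_itv/= => /andP[? ?].
  by apply/andP; split; lra.
rewrite in_itv/= => /andP[y0 yx]; rewrite h0 ?y0/= ?(lt_le_trans yx)//.
by rewrite mul0r => /eqP; rewrite subr_eq0 => /eqP.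
Qed.

(** By the initial conditions, first psi and then phi is the constant 0. *)
Lemma derive_within2_eq0 phi psi chi : (forall x, A x -> is_derive_within phi x (psi x)) ->
  (forall x, A x -> is_derive_within psi x (chi x)) ->
  (forall x, 0 < x < T -> chi x = 0) -> phi 0 = 0 -> psi 0 = 0 ->
  forall x, A x -> phi x = 0.
Proof.
move=> h1 h2 h3 p0 q0 x Ax; rewrite (derive_within0_cst h1)// => y /andP[y0 yT].
by rewrite (derive_within0_cst h2)//= in_itv/= !ltW.
Qed.

End one_sided.

(** * Boxes and Borel sets of R^d *)

Section boxes.
Variables (R : realType) (d : nat).
Implicit Types (a b : 'I_d -> R) (U : set 'rV[R]_d).

Definition obox a b : set 'rV[R]_d := [set v | forall i, a i < v ord0 i < b i].
Definition cbox a b : set 'rV[R]_d := [set v | forall i, a i <= v ord0 i <= b i].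

Lemma measurable_rect (A : 'I_d -> set R) : (forall i, measurable (A i)) ->
  measurable [set v : 'rV[R]_d | forall i, A i (v ord0 i)].
Proof.
move=> mA.
rewrite (_ : [set v | _] = \bigcap_(i in [set: 'I_d])
      ((fun v : 'rV[R]_d => v ord0 i) @^-1` A i)); last first.
  by apply/seteqP; split => [v Bv i _|v Bv i]; [exact: Bv|exact: (Bv i)].
apply: fin_bigcap_measurable => // i _.
by rewrite -[X in measurable X]setTI; apply: measurable_coord.
Qed.

Lemma oboxE a b : obox a b = [set v | forall i, `]a i, b i[%classic (v ord0 i)].
Proof. by apply/seteqP; split => v /= h i; have := h i; rewrite in_itv. Qed.

Lemma cboxE a b : cbox a b = [set v | forall i, `[a i, b i]%classic (v ord0 i)].
Proof. by apply/seteqP; split => v /= h i; have := h i; rewrite in_itv. Qed.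

Lemma measurable_obox a b : measurable (obox a b).
Proof.
rewrite oboxE; apply: (@measurable_rect (fun i => `]a i, b i[%classic)) => i.
exact: measurable_itv.
Qed.

Lemma measurable_cbox a b : measurable (cbox a b).
Proof.
rewrite cboxE; apply: (@measurable_rect (fun i => `[a i, b i]%classic)) => i.
exact: measurable_itv.
Qed.

Lemma compact_cbox a b : compact (cbox a b).
Proof.
rewrite cboxE; apply: (@rV_compact _ _ (fun i => `[a i, b i]%classic)) => i.
exact: segment_compact.
Qed.

Lemma lebesgue_cbox_fin a b : (lebesgue_rV d (cbox a b) < +oo)%E.
Proof.
rewrite cboxE (@lebesgue_rV_prod R d (fun i => `[a i, b i]%classic)); last first.
  by move=> i; exact: measurable_itv.
have : (0 <= \prod_(i < d) @lebesgue_measure R `[a i, b i]%classic < +oo)%E.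
  elim/big_rec : _ => [|i x _ /andP[x0 xoo]]; first by rewrite lee01 ltry.
  rewrite mule_ge0//= lte_mul_pinfty// ?ge0_fin_numE//.
  by have := @lebesgue_measure_itv R `[a i, b i] => /= ->; case: ifP => _; rewrite ?ltry.
by move=> /andP[].
Qed.

(** Boxes with rational corners, which are countably many and are enumerated by
    [unpickle]; only those whose closure stays in U are kept, so that bump
    functions on them are test functions in U. *)
Lemma open_boxes U : open U -> exists (a b : nat -> 'I_d -> R) (D : set nat),
  U = \bigcup_(n in D) obox (a n) (b n) /\
  forall n, D n -> cbox (a n) (b n) `<=` U.
Proof.
move=> oU.
pose a n : 'I_d -> R := if unpickle n is Some q then
  (fun i => ratr ((q : {ffun 'I_d -> rat} * {ffun 'I_d -> rat}).1 i)) else cst 0.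
pose b n : 'I_d -> R := if unpickle n is Some q then
  (fun i => ratr ((q : {ffun 'I_d -> rat} * {ffun 'I_d -> rat}).2 i)) else cst 0.
exists a, b, [set n | cbox (a n) (b n) `<=` U]; split => //.
apply/seteqP; split => [x Ux|x [n /= nU xn]]; last first.
  by apply: nU => i; have /andP[? ?] := xn i; rewrite !ltW.
have : nbhs x U by exact: open_nbhs_nbhs.
move=> /nbhs_ballP[e /= e0 eU].
have exa i : exists q : rat, ratr q \in `](x ord0 i - e), (x ord0 i)[.
  by apply: rat_in_itvoo; rewrite ltrBlDr ltrDl.
have exb i : exists q : rat, ratr q \in `](x ord0 i), (x ord0 i + e)[.
  by apply: rat_in_itvoo; rewrite ltrDl.
have [qa aP] := choice exa; have [qb bP] := choice exb.
have an i : a (pickle (finfun qa, finfun qb)) i = ratr (qa i).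
  by rewrite /a pickleK/= ffunE.
have bn i : b (pickle (finfun qa, finfun qb)) i = ratr (qb i).
  by rewrite /b pickleK/= ffunE.
exists (pickle (finfun qa, finfun qb)) => /=; last first.
  move=> i; rewrite an bn.
  have := aP i; have := bP i; rewrite !in_itv/= => /andP[-> _] /andP[_ ->] //.
move=> v vP; apply: eU; split => // i j; rewrite (ord1 i).
have := aP j; have := bP j; rewrite !in_itv/= => /andP[b1 b2] /andP[a1 a2].
have := vP j; rewrite an bn => /andP[v1 v2].
rewrite /ball /= ltr_norml; apply/andP; split; lra.
Qed.

Lemma measurable_open U : open U -> measurable U.
Proof.
move=> /open_boxes[a [b [D [-> _]]]].
by apply: bigcup_measurable => n _; exact: measurable_obox.
Qed.

Lemma continuous_measurable_rV (f : 'rV[R]_d -> R) : continuous f ->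
  measurable_fun [set: 'rV[R]_d] f.
Proof.
move=> cf; apply: (measurability _ (RGenOpens.measurableE R)).
move=> _ [_ [a [b ->] <-]]; rewrite setTI; apply: measurable_open.
by apply: open_comp => //; exact: interval_open.
Qed.

End boxes.

(** * A flat function *)

Section flat.
Variable R : realType.
Implicit Types (P : {poly R}) (c x y : R).

(** The polynomial factor makes the family stable under differentiation
    ([flatD]), so that all derivatives are obtained at once. *)
Definition flat c P x := if 0 < x then P.[x^-1] * expR (- c / x) else 0.

(** By induction on the degree: of the two factors of
    [expR (c * y) = expR (c / 2 * y) * expR (c / 2 * y)], one bounds P and the
    other the additional factor y. *)
Lemma poly_le_expR P c : 0 < c -> exists C : R, 0 <= C /\
  forall y, 0 <= y -> `|P.[y]| <= C * expR (c * y).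
Proof.
elim/poly_ind: P c => [|P a IH] c c0.
  by exists 0; split => // y _; rewrite hornerC normr0 mul0r.
have c20 : 0 < c / 2 by lra.
have [C [C0 CP]] := IH _ c20.
exists (C * (2 / c) + `|a|); split.
  by rewrite addr_ge0// mulr_ge0// divr_ge0// ltW.
move=> y y0; rewrite hornerMXaddC mulrDl; apply: le_trans (ler_normD _ _) _.
apply: lerD; last first.
  by rewrite ler_peMr// -expR0 ler_expR mulr_ge0// ltW.
rewrite normrM (ger0_norm y0).
have -> : c * y = c / 2 * y + c / 2 * y by field.
have h : y <= 2 / c * expR (c / 2 * y).
  have : 1 + c / 2 * y <= expR (c / 2 * y) by exact: expR_ge1Dx.
  set X := expR _ => h; rewrite -(ler_pM2l c20).
  have -> : c / 2 * (2 / c * X) = X by field; lra.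
  lra.
have := CP _ y0; rewrite expRD; set X := expR _ in h * => h'.
apply: le_trans (ler_pM (normr_ge0 _) y0 h' h) _.
by rewrite le_eqVlt; apply/orP; left; apply/eqP; ring.
Qed.

Definition flatD c P := 'X^2 * (c%:P * P - P^`()).

Lemma is_derive_flat_pos c P x : 0 < x ->
  is_derive x 1 (fun y => P.[y^-1] * expR (- c / y)) ((flatD c P).[x^-1] * expR (- c / x)).
Proof.
move=> x0; have xn0 : x != 0 by rewrite gt_eqF.
have h1 : is_derive x 1 (fun y : R => y^-1) (- x ^- 2).
  apply: is_derive_eq (is_deriveV _ _) _ => //.
  by rewrite /GRing.scale /= mulr1.
have h2 : is_derive x 1 (fun y : R => P.[y^-1]) (P^`().[x^-1] * (- x ^- 2)).
  exact: (@is_derive1_comp _ (horner P) (fun y => y^-1)).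
have h3 : is_derive x 1 (fun y : R => - c / y) (- c * (- x ^- 2)).
  have := @is_deriveZ _ _ _ (fun y : R => y^-1) (- c) x 1 _ h1.
  by [].
have h4 : is_derive x 1 (fun y : R => expR (- c / y)) (expR (- c / x) * (- c * (- x ^- 2))).
  exact: (@is_derive1_comp _ expR (fun y => - c / y)).
apply: is_derive_eq (is_deriveM h2 h4) _.
rewrite /flatD !hornerE /GRing.scale /=; field.
exact: xn0.
Qed.

(** At 0, the bound of P X^2 by a multiple of the exponential shows that
    [flat c P] is at most quadratic there. *)
Lemma is_derive_flat c P x : 0 < c -> is_derive x 1 (flat c P) (flat c (flatD c P) x).
Proof.
move=> c0; rewrite {2}/flat; case: ltP => x0.
- apply: near_eq_is_derive (is_derive_flat_pos c P x0) => //.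
  near=> y; rewrite /flat ifT//; near: y; exact: lt_nbhsr.
- have [xn|x0'] := ltP x 0.
    apply: near_eq_is_derive (is_derive_cst (0:R) x 1) => //.
    near=> y; rewrite /flat ifF//; apply/negbTE; rewrite -leNgt ltW//; near: y; exact: lt_nbhsl.
  have {x0 x0'} -> : x = 0 by lra.
  have [C [C0 CP]] := poly_le_expR (P * 'X^2) c0.
  have bnd h : `|flat c P h| <= C * h ^+ 2.
    rewrite /flat; case: ltP => h0; last by rewrite normr0 mulr_ge0// sqr_ge0.
    have := CP h^-1; rewrite invr_ge0 ltW// => /(_ isT).
    rewrite hornerM hornerXn !normrM.
    have h2 : 0 < h ^+ 2 by rewrite exprn_gt0.
    have -> : `|h^-1| * `|h^-1| = (h ^+ 2)^-1.
      by rewrite -expr2 real_normK ?num_real// exprVn.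
    rewrite [`|expR _|]ger0_norm ?expR_ge0// mulNr expRN.
    rewrite ler_pdivrMr// ler_pdivrMr ?expR_gt0// => hh.
    by rewrite mulrAC.
  have h' : (fun y => y^-1 *: (flat c P (y *: (1:R) + 0) - flat c P 0)) @ 0^' --> (0:R).
    apply/cvgr0Pnorm_lt => e e0.
    have e1 : 0 < e / (C + 1) by rewrite divr_gt0// ltr_wpDl.
    near=> y.
    have yn0 : y != 0 by near: y; exact: nbhs_dnbhs_neq.
    have ye : `|y| < e / (C + 1).
      near: y; apply: nbhs_dnbhs; near=> y; near: y.
      by apply/nbhs_ballP; exists (e / (C + 1)) => //= y; rewrite /ball /= sub0r normrN.
    rewrite [flat c P 0]/flat ltxx subr0 addr0 [y *: 1]mulr1 normrZ normfV.
    rewrite mulrC ltr_pdivrMr ?normr_gt0//; apply: le_lt_trans (bnd _) _.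
    rewrite -[y ^+ 2]real_normK ?num_real// expr2 mulrA ltr_pM2r ?normr_gt0//.
    move: ye; rewrite ltr_pdivlMr; last by lra.
    by have := normr_ge0 y; lra.
  split; first by apply/cvg_ex; exists 0; exact: h'.
  exact: cvg_lim h'.
Unshelve. all: by end_near.
Qed.

Lemma flat_continuous c P : 0 < c -> continuous (flat c P).
Proof.
move=> c0 x; apply: differentiable_continuous; apply/derivable1_diffP.
by have [] := is_derive_flat P x c0.
Qed.

End flat.

(** * Bump functions and the fundamental lemma of the calculus of variations *)

Section smooth_class.
Variables (R : realType) (d : nat).
Implicit Types (f : 'rV[R]_d -> R) (x : 'rV[R]_d).

(** A class containing the partial derivatives of its elements, so that these
    are smooth by induction on the order of differentiation. *)
Inductive smooth_expr : ('rV[R]_d -> R) -> Prop :=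
| smooth_cst c : smooth_expr (cst c)
| smooth_flat c P s t i : 0 < c -> smooth_expr (fun x => flat c P (s * x ord0 i + t))
| smooth_add f g : smooth_expr f -> smooth_expr g -> smooth_expr (f + g)
| smooth_mul f g : smooth_expr f -> smooth_expr g -> smooth_expr (f * g).

Lemma smooth_expr_continuous f : smooth_expr f -> continuous f.
Proof.
elim=> [c|c P s t i c0|f' g _ cf _ cg|f' g _ cf _ cg] x.
- exact: cst_continuous.
- apply: (@continuous_comp _ _ _ (fun x : 'rV[R]_d => s * x ord0 i + t) (flat c P)).
    apply: continuousD; last exact: cst_continuous.
    by apply: continuousM; [exact: cst_continuous | exact: coord_continuous].
  exact: flat_continuous.
- by apply: continuousD; [exact: cf | exact: cg].
- by apply: continuousM; [exact: cf | exact: cg].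
Qed.

Lemma is_derive_coord (h : R -> R) (l : R) x (i j : 'I_d) :
  is_derive (x ord0 i) 1 h l ->
  is_derive x (delta_mx ord0 j) (fun x => h (x ord0 i)) (l *+ (i == j)).
Proof.
move=> [dh hl].
have [<-|ij] := eqVneq i j.
  have E : (fun k : R => k^-1 *: (h ((k *: delta_mx ord0 i + x) ord0 i) - h (x ord0 i)))
      = (fun k : R => k^-1 *: (h (k *: (1:R) + x ord0 i) - h (x ord0 i))).
    by apply/funext => k; rewrite !mxE !eqxx.
  split; first by rewrite /derivable E.
  by rewrite /derive E; exact: hl.
have E : (fun k : R => k^-1 *: (h ((k *: delta_mx ord0 j + x) ord0 i) - h (x ord0 i)))
      = cst 0.
  by apply/funext => k; rewrite !mxE (negbTE ij) andbF mulr0 add0r subrr scaler0.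
split; first by rewrite /derivable E; exact: is_cvg_cst.
by rewrite /derive E lim_cst.
Qed.

Lemma smooth_expr_derive f (j : 'I_d) : smooth_expr f ->
  exists f', smooth_expr f' /\ forall x, is_derive x (delta_mx ord0 j) f (f' x).
Proof.
elim=> [c|c P s t i c0|f1 g1 sf [f' [sf' df']] sg [g' [sg' dg']]
  |f1 g1 sf [f' [sf' df']] sg [g' [sg' dg']]].
- by exists (cst 0); split; [exact: smooth_cst | move=> x; exact: is_derive_cst].
- exists (cst (s *+ (i == j)) * (fun x => flat c (flatD c P) (s * x ord0 i + t))); split.
    by apply: smooth_mul; [exact: smooth_cst | exact: smooth_flat].
  move=> x.
  have := @is_derive_coord (fun y => flat c P (s * y + t))
    (flat c (flatD c P) (s * x ord0 i + t) * s) x i j.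
  move=> h; apply: is_derive_eq (h _) _; last first.
    by rewrite !fctE -mulrnAr mulrC.
  apply: (@is_derive1_comp _ (flat c P) (fun y => s * y + t)); first exact: is_derive_flat.
  have -> : (fun y => s * y + t) = (s *: @id R) + cst t by [].
  by apply: is_derive_eq; rewrite addr0 /GRing.scale /= mulr1.
- exists (f' + g'); split; first exact: smooth_add.
  by move=> x; exact: is_deriveD.
- exists (f1 * g' + g1 * f'); split.
    by apply: smooth_add; apply: smooth_mul.
  by move=> x; exact: is_deriveM.
Qed.

Lemma smooth_expr_smooth f : smooth_expr f -> smooth f.
Proof.
move=> sf s /=.
have sfs : smooth_expr (foldr (@partial_deriv R d) f s).
  elim: s => //= i s IH; have [g [sg dg]] := smooth_expr_derive i IH.
  rewrite (_ : partial_deriv _ _ = g) //; apply/funext => x.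
  by rewrite /partial_deriv; have [_ ->] := dg x.
split; first exact: smooth_expr_continuous.
by move=> x i; have [g [_ /(_ x)[]]] := smooth_expr_derive i sfs.
Qed.

(** The exponent makes the n-th function the (n+1)-st root of the function with
    index 0: these functions are positive exactly on the box, at most 1, and
    tend to its indicator. *)
Definition box_bump (a b : 'I_d -> R) n : 'rV[R]_d -> R := fun x =>
  \prod_i (flat n.+1%:R^-1 1 (x ord0 i - a i) * flat n.+1%:R^-1 1 (b i - x ord0 i)).

Lemma smooth_box_bump a b n : smooth_expr (box_bump a b n).
Proof.
have n0 : 0 < n.+1%:R^-1 :> R by rewrite invr_gt0 ltr0n.
rewrite /box_bump; elim: (index_enum _) => [|i s IH].
  by under eq_fun do rewrite big_nil; exact: smooth_cst.
under eq_fun do rewrite big_cons.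
apply: smooth_mul => //; apply: smooth_mul.
  under eq_fun do rewrite -[_ ord0 i]mul1r; exact: smooth_flat.
by under eq_fun do rewrite addrC -mulN1r; exact: smooth_flat.
Qed.

Lemma flat1_itv (c x : R) : 0 < c -> 0 <= flat c 1 x <= 1.
Proof.
move=> c0; rewrite /flat; case: ltP => x0; last by rewrite lexx ler01.
by rewrite hornerC mul1r expR_ge0 -expR0 ler_expR mulNr oppr_le0 divr_ge0 ?ltW.
Qed.

Lemma box_bump_itv a b n x : 0 <= box_bump a b n x <= 1.
Proof.
have n0 : 0 < n.+1%:R^-1 :> R by rewrite invr_gt0 ltr0n.
rewrite /box_bump; elim/big_rec : _ => [|i y _ /andP[y0 y1]]; first by rewrite ler01 lexx.
have /andP[u0 u1] := flat1_itv (x ord0 i - a i) n0.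
have /andP[v0 v1] := flat1_itv (b i - x ord0 i) n0.
by rewrite !mulr_ge0//= !mulr_ile1 ?mulr_ge0.
Qed.

Lemma box_bump_out a b n x : ~ obox a b x -> box_bump a b n x = 0.
Proof.
move=> /existsNP[i] /negP; rewrite negb_and -!leNgt => h.
rewrite /box_bump (bigD1 i)//= /flat.
case/orP: h => h; [rewrite ltNge subr_le0 h/= mul0r mul0r//|].
by rewrite [0 < b i - _]ltNge subr_le0 h/= mulr0 mul0r.
Qed.

Lemma box_bump_cvg a b x : box_bump a b n x @[n --> \oo] --> (\1_(obox a b) x : R).
Proof.
rewrite indicE; case: (pselect (obox a b x)) => [xab|xab]; last first.
  rewrite memNset// (_ : (fun n => _) = cst 0); first exact: cvg_cst.
  by apply/funext => n; rewrite box_bump_out.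
rewrite mem_set//= mulr1n.
have -> : (1 : R) = \prod_(i < d) (1 * 1) by rewrite big1// => i _; rewrite mulr1.
have lim1 (y : R) : 0 < y -> flat n.+1%:R^-1 1 y @[n --> \oo] --> (1 : R).
  move=> y0; rewrite /flat y0.
  under eq_fun do rewrite hornerC mul1r.
  have h : (fun n => - n.+1%:R^-1 / y) @ \oo --> - 0 / y.
    by apply: cvgM; [apply: cvgN; exact: cvg_harmonic | exact: cvg_cst].
  have := cvg_comp _ _ h (@continuous_expR R _); rewrite oppr0 mul0r expR0; exact.
apply: cvg_big => [|i _]; first exact: mul_continuous.
by have /andP[h1 h2] := xab i; apply: cvgM; apply: lim1; rewrite subr_gt0.
Qed.

Lemma test_box_bump (Omega : set 'rV[R]_d) a b n : cbox a b `<=` Omega ->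
  test_function Omega (box_bump a b n).
Proof.
move=> abO.
have cc : closed (cbox a b).
  by apply: compact_closed; [exact: norm_hausdorff | exact: compact_cbox].
have sub : closure [set x | box_bump a b n x != 0] `<=` cbox a b.
  rewrite closureE; apply: smallest_sub => // x /= /eqP h i.
  have : obox a b x by apply: contrapT => /box_bump_out.
  by move=> /(_ i) /andP[? ?]; rewrite !ltW.
split; [exact: smooth_expr_smooth (smooth_box_bump _ _ _) | | exact: subset_trans abO].
apply: subclosed_compact sub; [exact: closed_closure | exact: compact_cbox].
Qed.

End smooth_class.

Section fundamental_lemma.
Variables (R : realType) (d : nat) (Omega : set 'rV[R]_d).
Hypothesis oO : open Omega.
Local Notation leb := (@lebesgue_rV R d).
Local Notation mT := (measure_rV_display default_measure_display).
Variable g : 'rV[R]_d -> R.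
Hypothesis ig : leb.-integrable Omega (EFin \o g).
Hypothesis g0 : forall phi, test_function Omega phi ->
  \int[leb]_(x in Omega) (g x * phi x) = 0.

Let mO : measurable Omega := measurable_open oO.

(** Dominated convergence, the bump functions of the box being test functions. *)
Lemma box_integral0 a b : cbox a b `<=` Omega ->
  (\int[leb]_(x in obox a b) (g x)%:E = 0)%E.
Proof.
move=> abO.
have oO' : obox a b `<=` Omega.
  by move=> x xab; apply: abO => i; have /andP[? ?] := xab i; rewrite !ltW.
have mg : measurable_fun Omega g by apply/measurable_EFinP; exact: measurable_int ig.
pose f_ n x := (g x * box_bump a b n x)%:E.
pose f x := (g x * \1_(obox a b) x)%:E.
have mf_ n : measurable_fun Omega (f_ n).
  apply/measurable_EFinP/measurable_funM => //.
  apply: measurable_funTS; apply: continuous_measurable_rV.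
  exact: smooth_expr_continuous (smooth_box_bump _ _ _).
have mf : measurable_fun Omega f.
  apply/measurable_EFinP/measurable_funM => //.
  by apply: measurable_funTS; apply: measurable_indic; exact: measurable_obox.
have f_f : {ae leb, forall x, Omega x -> f_ ^~ x @ \oo --> f x}.
  apply/aeW => x _; apply: cvg_EFin; first exact: nearW.
  by apply: cvgM; [exact: cvg_cst | exact: box_bump_cvg].
have bnd n x : (`|f_ n x| <= `|(EFin \o g) x|)%E.
  rewrite /f_ /= lee_fin normrM ler_piMr//.
  by have /andP[? ?] := box_bump_itv a b n x; rewrite ger0_norm.
have igg : leb.-integrable Omega (fun x => `|(EFin \o g) x|)%E by exact: integrable_abse.
have [iF _ lim] := dominated_convergence mO mf_ mf f_f igg (aeW _ (fun x n _ => bnd n x)).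
have if_ n : leb.-integrable Omega (f_ n).
  by apply: le_integrable ig => // x _; exact: bnd.
have {lim} : (\int[leb]_(x in Omega) f x = 0)%E.
  have -> : 0%E = limn (fun n : nat => \int[leb]_(x in Omega) f_ n x)%E :> \bar R.
    rewrite (_ : (fun n => _) = cst 0%E) ?lim_cst//; apply/funext => n.
    rewrite -[LHS]fineK; first by congr EFin; apply: g0; exact: test_box_bump.
    exact: integrable_fin_num.
  exact/esym/cvg_lim.
rewrite integral_mkcond [in X in _ -> X]integral_mkcond => <-.
apply: eq_integral => x _; rewrite /f /patch indicE.
case: ifPn => [|xb]; last by rewrite mulr0; case: ifP.
by rewrite inE => /oO' Ox; rewrite mem_set//= mulr1.
Qed.

Let boxes : set (set 'rV[R]_d) := [set B | exists a b, B = obox a b].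

Lemma setI_obox (a b a' b' : 'I_d -> R) : obox a b `&` obox a' b' =
  obox (fun i => Num.max (a i) (a' i)) (fun i => Num.min (b i) (b' i)).
Proof.
apply/seteqP; split => [x [h h'] i|x h].
  by have /andP[h1 h2] := h i; have /andP[h3 h4] := h' i; rewrite gt_max lt_min h1 h2 h3 h4.
by split => i; have := h i; rewrite gt_max lt_min => /andP[/andP[h1 h2] /andP[h3 h4]];
  apply/andP.
Qed.

(** The preimage of an open interval by a coordinate is open, hence a countable
    union of boxes. *)
Lemma measurable_boxes (A : set 'rV[R]_d) : measurable A -> <<s boxes >> A.
Proof.
move: A; apply: smallest_sub; first exact: smallest_sigma_algebra.
rewrite -bigcup_seq/=; apply: bigcup_sub => i _ A [B mB <-].
pose sT : measurableType _ := g_sigma_algebraType boxes.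
have : measurable_fun [set: sT] (fun v : sT => (v : 'rV[R]_d) ord0 i).
  apply: (measurability _ (measurable_realfun.RGenOpens.measurableE R)).
  move=> _ [_ [a [b ->] <-]]; rewrite setTI.
  have : open ((fun v : 'rV[R]_d => v ord0 i) @^-1` `]a, b[%classic).
    apply: open_comp; last exact: interval_open.
    by move=> v _; exact: coord_continuous.
  move=> /open_boxes[a' [b' [D [-> _]]]]; apply: bigcup_measurable => n _.
  by apply: sub_sigma_algebra; exists (a' n), (b' n).
by move=> /(_ measurableT _ mB).
Qed.

(** The sets over which the integral of g vanishes form a Dynkin system that
    contains the boxes, and the boxes are stable under intersection. *)
Lemma box_ae0 a b : cbox a b `<=` Omega ->
  {ae leb, forall x, obox a b x -> g x = 0}.
Proof.
move=> abO; set Q := obox a b.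
have mQ : measurable Q by exact: measurable_obox.
have QO : Q `<=` Omega.
  by move=> x xab; apply: abO => i; have /andP[? ?] := xab i; rewrite !ltW.
have iQ : leb.-integrable Q (EFin \o g) by exact: integrableS ig.
have iQA A : measurable A -> leb.-integrable (Q `&` A) (EFin \o g).
  by move=> mA; apply: integrableS iQ => //; exact: measurableI.
pose H := [set A : set 'rV[R]_d | measurable A /\ (\int[leb]_(x in Q `&` A) (g x)%:E = 0)%E].
have dH : dynkin H.
  split.
  - by split => //; rewrite setIT; exact: box_integral0.
  - move=> A [mA A0]; split; first exact: measurableC.
    have QE : Q = (Q `&` A) `|` (Q `&` ~` A) by rewrite -setIUr setUv setIT.
    have := @integral_setU _ _ _ leb (Q `&` A) (Q `&` ~` A) (EFin \o g).
    rewrite -QE /= A0 add0e (box_integral0 abO) => <- //.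
    + exact: measurableI.
    + by apply: measurableI => //; exact: measurableC.
    + exact: measurable_int iQ.
    + by apply/disj_setPS => x [[_ ?] [_ ?]].
  - move=> F tF HF.
    have mF n : measurable (F n) by have [] := HF n.
    split; first exact: bigcupT_measurable.
    rewrite setI_bigcupr integral_bigcup.
    + by apply: eseries0 => n _ _; have [] := HF n.
    + exact: trivIset_setIl.
    + by move=> n; exact: measurableI.
    + by rewrite -setI_bigcupr; apply: iQA; exact: bigcupT_measurable.
have HA A : measurable A -> H A.
  move=> /measurable_boxes; rewrite -setI_closed_g_dynkin_g_sigma_algebra; last first.
    by move=> _ _ [a1 [b1 ->]] [a2 [b2 ->]]; rewrite setI_obox; eexists; eexists.
  apply: smallest_sub => // _ [a1 [b1 ->]]; split; first exact: measurable_obox.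
  rewrite setI_obox; apply: box_integral0.
  move=> x h; apply: abO => i; have := h i.
  by rewrite ge_max le_min => /andP[/andP[-> _] /andP[-> _]].
have := @integral_ae_eq _ _ _ leb Q mQ (cst 0%E) (EFin \o g) iQ (measurable_cst _).
move=> h; have {h} : ae_eq leb Q (EFin \o g) (cst 0%E).
  apply: h => E EQ mE; rewrite integral0.
  by have [_] := HA _ mE; rewrite setIidr.
by apply: filterS => x h /h [].
Qed.

(** Countably many boxes cover Omega. *)
Lemma fundamental_lemma : {ae leb, forall x, Omega x -> g x = 0}.
Proof.
have [a [b [D [OE DO]]]] := open_boxes oO.
rewrite OE.
have : forall n, leb.-negligible [set x | ~ (D n -> obox (a n) (b n) x -> g x = 0)].
  move=> n; have [Dn|nDn] := pselect (D n).
    have := box_ae0 (DO _ Dn); apply: negligibleS => x /= h h'; apply: h => _; exact: h'.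
  rewrite (_ : [set x | _] = set0); first exact: negligible_set0.
  by apply/seteqP; split => // x /=; apply; move=> /nDn.
move=> /negligible_bigcup; apply: negligibleS => x /= /not_implyP[[n Dn xn] gx].
by exists n => //= h; apply: gx; exact: h.
Qed.

End fundamental_lemma.

(** * Integrals and null sets *)

Section ae_integral.
Context dp (X : measurableType dp) (R : realType) (mu : {measure set X -> \bar R}).
Implicit Types (D : set X) (f g : X -> \bar R) (F G H : X -> R).

Import HBNNSimple.

Let lower_int f := ereal_sup [set sintegral mu h |
  h in [set h : {nnsfun X >-> R} | forall x, ((h x)%:E <= f x)%E]].

(** A simple function below f, set to 0 on the null set where f and g differ,
    is below g and keeps its integral. *)
Lemma lower_int_ae_le f g : (forall x, 0 <= g x)%E -> {ae mu, forall x, f x = g x} ->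
  (lower_int f <= lower_int g)%E.
Proof.
move=> g0 [N [mN N0 subN]].
apply: ge_ereal_sup => _ [h /= hf <-].
have mNC : measurable (~` N) by exact: measurableC.
have -> : sintegral mu h = sintegral mu (proj_nnsfun h mNC).
  rewrite -!integralT_nnsfun; apply: ge0_ae_eq_integral => //.
  - exact/measurable_EFinP.
  - exact/measurable_EFinP.
  - by move=> x _; rewrite lee_fin.
  - by move=> x _; rewrite lee_fin.
  exists N; split => // x /= /not_implyP[_ hx]; apply: contrapT => xN; apply: hx.
  by rewrite /= mindicE mem_set// mulr1.
apply: ereal_sup_ubound; exists (proj_nnsfun h mNC) => //= x.
rewrite mindicE; case: (boolP (x \in ~` N)) => [|xN]; last by rewrite mulr0.
rewrite inE => xN; rewrite mulr1; apply: le_trans (hf x) _.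
rewrite (_ : f x = g x)//; apply: contrapT => fg; apply: xN; exact: subN.
Qed.

(** The integral of a nonnegative function is a supremum over simple functions,
    whether or not the function is measurable. This is needed because the
    pairing of the load with a function of x is measurable in time only up to a
    null set. *)
Lemma ae_eq_lower_integral D f g : {ae mu, forall x, D x -> f x = g x} ->
  (\int[mu]_(x in D) f x = \int[mu]_(x in D) g x)%E.
Proof.
have pos f' g' : (forall x, 0 <= f' x)%E -> (forall x, 0 <= g' x)%E ->
    {ae mu, forall x, f' x = g' x} -> lower_int f' = lower_int g'.
  move=> f0 g0 fg; apply/eqP; rewrite eq_le !lower_int_ae_le//.
  by apply: filterS fg.
move=> fg; rewrite /integral; congr (_ - _)%E; apply: pos => //;
  by apply: filterS fg => x fg; rewrite ?funeposE ?funenegE /patch; case: ifPn => //;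
    rewrite inE => /fg ->.
Qed.

Lemma ae_eq_lower_Rintegral D F G : {ae mu, forall x, D x -> F x = G x} ->
  \int[mu]_(x in D) F x = \int[mu]_(x in D) G x.
Proof.
move=> FG; congr fine; apply: ae_eq_lower_integral.
by apply: filterS FG => x h /h ->.
Qed.

Variable D : set X.
Hypothesis mD : measurable D.

(** Integrability up to modification on a null set, on which no measurability is
    required. *)
Definition ae_int F := exists G, mu.-integrable D (EFin \o G) /\
  {ae mu, forall x, D x -> F x = G x}.

Lemma integrable_ae_int F : mu.-integrable D (EFin \o F) -> ae_int F.
Proof. by move=> iF; exists F; split => //; exact: aeW. Qed.

Lemma eq_ae_int F G : {ae mu, forall x, D x -> F x = G x} -> ae_int F -> ae_int G.
Proof.
move=> FG [H [iH FH]]; exists H; split => //.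
by apply: filterS2 FG FH => x h1 h2 Dx; rewrite -h1// h2.
Qed.

Lemma ae_int0 : ae_int (cst 0).
Proof. by apply: integrable_ae_int; exact: integrable0. Qed.

Lemma ae_int_lin c F G : ae_int F -> ae_int G -> ae_int (fun x => c * F x + G x).
Proof.
move=> [F' [iF FF]] [G' [iG GG]]; exists (fun x => c * F' x + G' x); split.
  rewrite (_ : _ \o _ = (fun x => c%:E * (EFin \o F') x + (EFin \o G') x)%E)//.
  by apply: integrableD => //; exact: integrableZl.
by apply: filterS2 FF GG => x h1 h2 Dx; rewrite h1// h2.
Qed.

Lemma ae_intD F G : ae_int F -> ae_int G -> ae_int (fun x => F x + G x).
Proof.
by move=> iF iG; have := ae_int_lin 1 iF iG; under eq_fun do rewrite mul1r.
Qed.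

Lemma ae_intZ c F : ae_int F -> ae_int (fun x => c * F x).
Proof.
by move=> iF; have := ae_int_lin c iF ae_int0; under eq_fun do rewrite addr0.
Qed.

Lemma ae_int_sum n (F : 'I_n -> X -> R) : (forall k, ae_int (F k)) ->
  ae_int (fun x => \sum_k F k x).
Proof.
move=> iF; elim: (index_enum _) => [|i r IH].
  by under eq_fun do rewrite big_nil; exact: ae_int0.
by under eq_fun do rewrite big_cons; exact: ae_intD.
Qed.

Lemma Rint_lin c F G : ae_int F -> ae_int G ->
  \int[mu]_(x in D) (c * F x + G x) =
  c * (\int[mu]_(x in D) F x) + \int[mu]_(x in D) G x.
Proof.
move=> [F' [iF FF]] [G' [iG GG]].
rewrite (ae_eq_lower_Rintegral FF) (ae_eq_lower_Rintegral GG).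
have iZ : mu.-integrable D (EFin \o (fun x => c * F' x)).
  rewrite (_ : EFin \o _ = (fun x => c%:E * (EFin \o F') x)%E)//.
  exact: integrableZl.
rewrite -RintegralZl// -RintegralD//.
by apply: ae_eq_lower_Rintegral; apply: filterS2 FF GG => x h1 h2 Dx; rewrite h1// h2.
Qed.

Lemma RintD F G : ae_int F -> ae_int G ->
  \int[mu]_(x in D) (F x + G x) = (\int[mu]_(x in D) F x) + \int[mu]_(x in D) G x.
Proof.
by move=> iF iG; rewrite -[X in X + _]mul1r -Rint_lin//; under eq_Rintegral do rewrite -[F _]mul1r.
Qed.

Lemma RintZ c F : ae_int F ->
  \int[mu]_(x in D) (c * F x) = c * \int[mu]_(x in D) F x.
Proof.
move=> iF; have := Rint_lin c iF ae_int0.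
rewrite /= [X in _ + X]Rintegral_cst// mul0r addr0 => <-.
by apply: eq_Rintegral => x _; rewrite addr0.
Qed.

Lemma Rint_sum n (F : 'I_n -> X -> R) : (forall k, ae_int (F k)) ->
  \int[mu]_(x in D) (\sum_k F k x) = \sum_k \int[mu]_(x in D) F k x.
Proof.
move=> iF; suff [] : ae_int (fun x => \sum_k F k x) /\ \int[mu]_(x in D) (\sum_k F k x) =
   \sum_k \int[mu]_(x in D) F k x by [].
elim: (index_enum _) => [|i r [IH1 IH2]].
  split; first by under eq_fun do rewrite big_nil; exact: ae_int0.
  rewrite big_nil; under eq_Rintegral do rewrite big_nil.
  by rewrite Rintegral_cst// mul0r.
split; first by under eq_fun do rewrite big_cons; exact: ae_intD.
by rewrite big_cons -IH2 -RintD//; under eq_Rintegral do rewrite big_cons.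
Qed.

Lemma Rint_ge0 F : {ae mu, forall x, D x -> 0 <= F x} -> 0 <= \int[mu]_(x in D) F x.
Proof.
move=> F0; rewrite (@ae_eq_lower_Rintegral _ F (fun x => Num.max 0 (F x))).
  by apply: Rintegral_ge0 => x _; rewrite le_max lexx.
by apply: filterS F0 => x F0 /F0 ?; rewrite max_r.
Qed.

Lemma Rint_le F G : ae_int F -> ae_int G ->
  {ae mu, forall x, D x -> F x <= G x} ->
  \int[mu]_(x in D) F x <= \int[mu]_(x in D) G x.
Proof.
move=> iF iG FG.
have := @Rint_ge0 (fun x => -1 * F x + G x).
rewrite Rint_lin// mulN1r addrC subr_ge0; apply.
by apply: filterS FG => x h /h; rewrite mulN1r addrC subr_ge0.
Qed.

Lemma Rint_eq0 F : ae_int F -> {ae mu, forall x, D x -> 0 <= F x} ->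
  \int[mu]_(x in D) F x = 0 -> {ae mu, forall x, D x -> F x = 0}.
Proof.
move=> [G [iG FG]] F0; rewrite (ae_eq_lower_Rintegral FG) => G0.
have mG := measurable_int _ iG.
have : (\int[mu]_(x in D) `|(EFin \o G) x| = 0)%E.
  rewrite -[RHS](congr1 EFin G0) fineK; last exact: integrable_fin_num.
  apply: ae_eq_lower_integral; apply: filterS2 FG F0 => x h1 h2 Dx.
  by rewrite gee0_abs//= lee_fin -h1// h2.
move/(ae_eq_integral_abs mu mD mG); apply: filterS2 FG => x h1 h2 Dx.
by rewrite h1//; have /= [] := h2 Dx.
Qed.

End ae_integral.

(** * L^2 and weak gradients *)

Section L2_theory.
Variables (R : realType) (d : nat) (Omega : set 'rV[R]_d).
Hypothesis mO : measurable Omega.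
Local Notation leb := (@lebesgue_rV R d).
Local Notation L2 := (L2 Omega).
Local Notation L2ip := (L2ip Omega).
Implicit Types u v w : 'rV[R]_d -> R.

Lemma L2_integrable_prod u v : L2 u -> L2 v ->
  leb.-integrable Omega (EFin \o (fun x => u x * v x)).
Proof.
have sq w : L2 w -> leb.-integrable Omega (EFin \o (fun x => w x ^+ 2)).
  move=> [mw iw]; apply/integrableP; split.
    by apply/measurable_EFinP; exact: measurable_funX.
  rewrite (eq_integral (fun x => (w x ^+ 2)%:E))// => x _.
  by rewrite gee0_abs//= lee_fin sqr_ge0.
move=> Lu Lv; have := integrableD mO (sq _ Lu) (sq _ Lv).
apply: le_integrable => //.
  by apply/measurable_EFinP/measurable_funM; [exact: Lu.1 | exact: Lv.1].
move=> x _ /=; rewrite lee_fin normrM [leRHS]ger0_norm; last by rewrite addr_ge0 ?sqr_ge0.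
rewrite -[u x ^+ 2]real_normK ?num_real// -[v x ^+ 2]real_normK ?num_real//.
set a := `|u x|; set b := `|v x|; nra.
Qed.

Lemma ae_int_L2 u v : L2 u -> L2 v -> ae_int leb Omega (fun x => u x * v x).
Proof. by move=> Lu Lv; apply: integrable_ae_int; exact: L2_integrable_prod. Qed.

Lemma L2_lin c u v : L2 u -> L2 v -> L2 (fun x => c * u x + v x).
Proof.
move=> Lu Lv; split.
  apply: measurable_funD; last exact: Lv.1.
  by apply: measurable_funM => //; exact: Lu.1.
have -> : (\int[leb]_(x in Omega) ((c * u x + v x) ^+ 2)%:E =
   \int[leb]_(x in Omega) `|((c * u x + v x) ^+ 2)%:E|)%E.
  by apply: eq_integral => x _; rewrite gee0_abs// lee_fin sqr_ge0.
suff /integrableP[_] : leb.-integrable Omega (EFin \o (fun x => (c * u x + v x) ^+ 2)) by [].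
have i1 := L2_integrable_prod Lu Lu; have i2 := L2_integrable_prod Lu Lv.
have i3 := L2_integrable_prod Lv Lv.
rewrite (_ : EFin \o _ = (fun x => (c ^+ 2)%:E * (EFin \o (fun x => u x * u x)%R) x +
   ((2 * c)%:E * (EFin \o (fun x => u x * v x)%R) x + (EFin \o (fun x => v x * v x)%R) x))%E).
  apply: integrableD => //; first exact: integrableZl.
  by apply: integrableD => //; exact: integrableZl.
by apply/funext => x /=; congr EFin; ring.
Qed.

Lemma L2_0 : L2 (cst 0).
Proof.
split; first exact: measurable_cst.
by under eq_integral do rewrite expr0n /=; rewrite integral0 ltry.
Qed.

Lemma L2_sum n (c : 'I_n -> R) (v : 'I_n -> 'rV[R]_d -> R) : (forall k, L2 (v k)) ->
  L2 (fun x => \sum_k c k * v k x).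
Proof.
move=> Lv; elim: (index_enum _) => [|i r IH].
  by under eq_fun do rewrite big_nil; exact: L2_0.
by under eq_fun do rewrite big_cons; exact: L2_lin.
Qed.

Lemma L2ipC u v : L2ip u v = L2ip v u.
Proof. by apply: eq_Rintegral => x _; rewrite mulrC. Qed.

Lemma L2ip_lin c u v w : L2 u -> L2 v -> L2 w ->
  L2ip (fun x => c * u x + v x) w = c * L2ip u w + L2ip v w.
Proof.
move=> Lu Lv Lw; rewrite -Rint_lin//; try exact: ae_int_L2.
by apply: eq_Rintegral => x _; ring.
Qed.

Lemma L2ip_sum n (c : 'I_n -> R) (v : 'I_n -> 'rV[R]_d -> R) w :
  (forall k, L2 (v k)) -> L2 w ->
  L2ip (fun x => \sum_k c k * v k x) w = \sum_k c k * L2ip (v k) w.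
Proof.
move=> Lv Lw.
rewrite (_ : L2ip _ _ = \int[leb]_(x in Omega) (\sum_k c k * (v k x * w x))).
  rewrite Rint_sum//; last by move=> k; apply: ae_intZ => //; exact: ae_int_L2.
  by apply: eq_bigr => k _; rewrite RintZ//; exact: ae_int_L2.
by apply: eq_Rintegral => x _; rewrite mulr_suml; apply: eq_bigr => k _; rewrite mulrA.
Qed.

Lemma L2ip_ge0 u : 0 <= L2ip u u.
Proof. by apply: Rintegral_ge0 => x _; rewrite -expr2 sqr_ge0. Qed.

Lemma L2ip_eq0 u : L2 u -> L2ip u u = 0 -> {ae leb, forall x, Omega x -> u x = 0}.
Proof.
move=> Lu /(Rint_eq0 mO (ae_int_L2 Lu Lu)) h.
have {h} : {ae leb, forall x, Omega x -> u x * u x = 0}.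
  by apply: h; apply: aeW => x _; rewrite -expr2 sqr_ge0.
by apply: filterS => x h /h /eqP; rewrite mulf_eq0 orbb => /eqP.
Qed.

(** The square of c u + v has a nonnegative integral for every c. *)
Lemma L2ip_cauchy_schwarz u v : L2 u -> L2 v ->
  L2ip u v ^+ 2 <= L2ip u u * L2ip v v.
Proof.
move=> Lu Lv.
have Q c : 0 <= c ^+ 2 * L2ip u u + 2 * c * L2ip u v + L2ip v v.
  have := L2ip_ge0 (fun x => c * u x + v x).
  have Luv := L2_lin c Lu Lv.
  rewrite L2ip_lin// (L2ipC u) (L2ipC v) !L2ip_lin// (L2ipC v u); lra.
set a := L2ip u u in Q *; set b := L2ip u v in Q *; set e := L2ip v v in Q *.
have a0 : 0 <= a := L2ip_ge0 u.
have [a_eq|an0] := eqVneq a 0.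
  rewrite a_eq mul0r; have [->|bn0] := eqVneq b 0; first by rewrite expr0n.
  have := Q (- (1 + e) / (2 * b)); rewrite a_eq mulr0 add0r.
  have -> : 2 * (- (1 + e) / (2 * b)) * b = - (1 + e) by field.
  lra.
(* the minimum of the quadratic function in Q *)
have := Q (- b / a).
have -> : (- b / a) ^+ 2 * a + 2 * (- b / a) * b + e = (a * e - b ^+ 2) / a by field.
by rewrite pmulr_lge0 ?invr_gt0 ?lt_def ?an0// subr_ge0.
Qed.

Hypothesis fO : (leb Omega < +oo)%E.

(** Truncating u at M makes the bound hold everywhere. *)
Lemma bounded_L2 u M : measurable_fun Omega u ->
  {ae leb, forall x, Omega x -> `|u x| <= M} -> L2 u.
Proof.
move=> mu uM; split => //.
apply: (@le_lt_trans _ _ (\int[leb]_(x in Omega) (M ^+ 2)%:E)%E); last first.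
  by rewrite integral_cst// lte_mul_pinfty// ?lee_fin ?sqr_ge0// ltry.
rewrite (_ : (\int[leb]_(x in Omega) (u x ^+ 2)%:E =
   \int[leb]_(x in Omega) (Num.min (u x ^+ 2) (M ^+ 2))%:E)%E); last first.
  apply: ae_eq_lower_integral; apply: filterS uM => x h /h uM.
  rewrite min_l// -[u x ^+ 2]real_normK ?num_real//.
  by rewrite lerXn2r ?nnegrE// (le_trans _ uM).
apply: ge0_le_integral => //.
- by move=> x _; rewrite lee_fin le_min !sqr_ge0.
- apply/measurable_EFinP; apply: measurable_minr; last exact: measurable_cst.
  exact: measurable_funX.
- by move=> x _; rewrite lee_fin ge_min lexx orbT.
Qed.

End L2_theory.

Section weak_gradient.
Variables (R : realType) (d : nat) (Omega : set 'rV[R]_d).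
Hypothesis oO : open Omega.
Hypothesis bO : bounded_set Omega.
Local Notation leb := (@lebesgue_rV R d).
Local Notation L2 := (L2 Omega).
Implicit Types (u v w : 'rV[R]_d -> R) (g h : 'rV[R]_d -> 'rV[R]_d).

Let mO : measurable Omega := measurable_open oO.

Lemma bounded_coord : exists M : R, 0 <= M /\
  forall x i, Omega x -> `|x ord0 i| <= M.
Proof.
have [M [Mr MP]] := bO; exists (`|M| + 1); split => [|x i Ox].
  by rewrite addr_ge0.
have : M < `|M| + 1 by have := ler_norm M; lra.
move=> /MP /(_ _ Ox); apply: le_trans.
rewrite [leRHS]/Num.norm /= mx_normE -[leLHS]nngE num_le.
exact: (le_bigmax _ (fun ij : 'I_1 * 'I_d => `|x ij.1 ij.2|%:nng) (ord0, i)).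
Qed.

Lemma sub_cbox : exists M : R, 0 <= M /\ Omega `<=` cbox (cst (- M)) (cst M).
Proof.
have [M [M0 MP]] := bounded_coord; exists M; split => // x Ox i.
by rewrite -ler_norml; exact: MP.
Qed.

Lemma lebesgue_bounded : (leb Omega < +oo)%E.
Proof.
have [M [_ sub]] := sub_cbox.
apply: le_lt_trans (lebesgue_cbox_fin (cst (- M)) (cst M)).
by apply: le_measure => //; rewrite inE //; exact: measurable_cbox.
Qed.

Lemma continuous_L2 u : continuous u -> L2 u.
Proof.
move=> cu; have [M [_ sub]] := sub_cbox.
have : compact (u @` cbox (cst (- M)) (cst M)).
  apply: continuous_compact; last exact: compact_cbox.
  exact: continuous_subspaceT.
move=> /compact_bounded [N [Nr NP]].
apply: (@bounded_L2 _ _ _ mO lebesgue_bounded u (`|N| + 1)).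
  by apply: measurable_funTS; exact: continuous_measurable_rV.
apply: aeW => x /sub Bx; apply: NP; last by exists x.
by have := ler_norm N; lra.
Qed.

Lemma test_L2 phi : test_function Omega phi -> L2 phi.
Proof. by move=> [/(_ [::])[/continuous_L2]]. Qed.

Lemma test_deriv_L2 phi i : test_function Omega phi -> L2 (partial_deriv i phi).
Proof. by move=> [/(_ [:: i])[/continuous_L2]]. Qed.

Lemma weak_grad_lin c u v g h : L2 u -> L2 v ->
  is_weak_grad Omega u g -> is_weak_grad Omega v h ->
  is_weak_grad Omega (fun x => c * u x + v x) (fun x => c *: g x + h x).
Proof.
move=> Lu Lv [Lg gP] [Lh hP]; split => [i|phi tphi i].
  by under eq_fun do rewrite !mxE; exact: L2_lin.
have Lp := test_L2 tphi; have Ld := test_deriv_L2 i tphi.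
have := L2ip_lin mO c Lu Lv Ld; rewrite /L2ip => ->.
under [in RHS]eq_Rintegral do rewrite !mxE.
have := L2ip_lin mO c (Lg i) (Lh i) Lp; rewrite /L2ip => ->.
by rewrite gP// hP// opprD mulrN.
Qed.

Lemma weak_grad_ext u v g : {ae leb, forall x, Omega x -> u x = v x} ->
  is_weak_grad Omega u g -> is_weak_grad Omega v g.
Proof.
move=> uv [Lg gP]; split => // phi tphi i; rewrite -gP//.
by apply: ae_eq_lower_Rintegral; apply: filterS uv => x h /h ->.
Qed.

Lemma weak_grad0 : is_weak_grad Omega (cst 0) (cst 0).
Proof.
split => [i|phi tphi i]; first by under eq_fun do rewrite mxE; exact: L2_0.
under eq_Rintegral do rewrite mul0r.
under [in RHS]eq_Rintegral do rewrite mxE mul0r.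
by rewrite !Rintegral_cst// mul0r oppr0.
Qed.

Lemma weak_grad_sum n (c : 'I_n -> R) (v : 'I_n -> 'rV[R]_d -> R)
    (g : 'I_n -> 'rV[R]_d -> 'rV[R]_d) :
  (forall k, L2 (v k)) -> (forall k, is_weak_grad Omega (v k) (g k)) ->
  is_weak_grad Omega (fun x => \sum_k c k * v k x) (fun x => \sum_k c k *: g k x).
Proof.
move=> Lv Wg.
suff [] : L2 (fun x => \sum_k c k * v k x) /\
  is_weak_grad Omega (fun x => \sum_k c k * v k x) (fun x => \sum_k c k *: g k x) by [].
elim: (index_enum _) => [|i r [IH1 IH2]].
  split; first by under eq_fun do rewrite big_nil; exact: L2_0.
  under eq_fun do rewrite big_nil.
  by under [X in is_weak_grad _ _ X]eq_fun do rewrite big_nil; exact: weak_grad0.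
split; first by under eq_fun do rewrite big_cons; exact: L2_lin.
under eq_fun do rewrite big_cons.
under [X in is_weak_grad _ _ X]eq_fun do rewrite big_cons.
exact: weak_grad_lin.
Qed.

(** The components of g - h are orthogonal to all test functions; they are
    integrable because Omega is bounded. *)
Lemma weak_grad_unique u g h : is_weak_grad Omega u g -> is_weak_grad Omega u h ->
  {ae leb, forall x, Omega x -> g x = h x}.
Proof.
move=> [Lg gP] [Lh hP].
have key i : {ae leb, forall x, Omega x -> g x ord0 i = h x ord0 i}.
  pose w x := -1 * h x ord0 i + g x ord0 i.
  have Lw : L2 w by exact: L2_lin.
  have L1 : L2 (cst 1) by apply: continuous_L2 => x; exact: cst_continuous.
  have iw : leb.-integrable Omega (EFin \o w).
    have := L2_integrable_prod mO Lw L1.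
    by apply: eq_integrable => // x _ /=; rewrite mulr1.
  have := @fundamental_lemma _ _ _ oO w iw.
  case=> [|N [mN N0 sub]].
    move=> phi tphi; have Lp := test_L2 tphi.
    have := L2ip_lin mO (-1) (Lh i) (Lg i) Lp; rewrite /L2ip /w => ->.
    have := gP _ tphi i; rewrite hP// => /eqP; rewrite eqr_opp => /eqP ->.
    by rewrite mulN1r addNr.
  exists N; split => // x /= ne; apply: sub => /= h0; apply: ne => Ox.
  by have := h0 Ox; rewrite /w mulN1r addrC => /eqP; rewrite subr_eq0 => /eqP.
have : {ae leb, forall x, forall i, Omega x -> g x ord0 i = h x ord0 i}.
  exact: filter_forall.
apply: filterS => x e Ox; apply/rowP => i; exact: e.
Qed.

Lemma gradP u : H1 Omega u -> is_weak_grad Omega u (grad Omega u).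
Proof.
move=> [_ ex]; rewrite /grad.
exact: (@xgetPex _ _ [set g | is_weak_grad Omega u g]).
Qed.

(** [grad] chooses a weak gradient for each function separately, so it is
    determined up to null sets only; it is computed by exhibiting any weak
    gradient of an almost everywhere equal function. *)
Lemma gradE u v g : {ae leb, forall x, Omega x -> u x = v x} ->
  is_weak_grad Omega v g -> {ae leb, forall x, Omega x -> grad Omega u x = g x}.
Proof.
move=> uv vg.
have ug : is_weak_grad Omega u g.
  by apply: weak_grad_ext vg; apply: filterS uv => x h /h.
have gu : is_weak_grad Omega u (grad Omega u).
  by rewrite /grad; apply: (@xgetPex _ _ [set g | is_weak_grad Omega u g]); exists g.
exact: weak_grad_unique gu ug.
Qed.

End weak_gradient.

(** * The discrete space *)

Section C2.
Variables (R : realType) (T : R).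
Hypothesis T0 : 0 < T.
Local Notation A := (`[0, T]%classic : set R).
Local Notation is_derive_within := (is_derive_within T).

(** [derive_within A phi] agrees with phi1 on A only, so that its derivative is
    obtained through [eq_is_derive_within]. *)
Lemma derive_within2E phi phi1 phi2 : (forall x, A x -> is_derive_within phi x (phi1 x)) ->
  (forall x, A x -> is_derive_within phi1 x (phi2 x)) ->
  forall x, A x -> derive_within A phi x = phi1 x /\
    is_derive_within (derive_within A phi) x (phi2 x) /\
    derive_within A (derive_within A phi) x = phi2 x.
Proof.
move=> h1 h2 x Ax.
have e y : A y -> derive_within A phi y = phi1 y.
  by move=> Ay; apply: is_derive_withinE => //; exact: h1.
have h : is_derive_within (derive_within A phi) x (phi2 x).
  by apply: eq_is_derive_within (h2 _ Ax) => // y /e.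
by split; [exact: e | split => //; exact: is_derive_withinE].
Qed.

Lemma derive_within_C2 phi phi1 phi2 : (forall x, A x -> is_derive_within phi x (phi1 x)) ->
  (forall x, A x -> is_derive_within phi1 x (phi2 x)) ->
  {within A, continuous phi2} -> C2_on A phi.
Proof.
move=> h1 h2 c2; split.
- by move=> x Ax; apply/cvg_ex; exists (phi1 x); exact: h1.
- move=> x Ax; apply/cvg_ex; exists (phi2 x).
  by have [_ []] := derive_within2E h1 h2 Ax.
- apply: subspace_eq_continuous c2 => x; rewrite inE => Ax /=.
  by rewrite /from_subspace; have [_ [_ ->]] := derive_within2E h1 h2 Ax.
Qed.

Lemma U_tau_scale Nt tau r phi c : U_tau T Nt tau r phi ->
  U_tau T Nt tau r (fun t => phi t * c).
Proof.
have A0 : A 0 by rewrite /= in_itv/= lexx ltW.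
move=> [[[h1 h2 h3] hq] p0 p1].
have H1 x : A x -> is_derive_within (fun t => phi t * c) x (derive_within A phi x * c).
  by move=> Ax; apply: is_derive_withinZ; exact: h1.
have H2 x : A x -> is_derive_within (fun t => derive_within A phi t * c) x
    (derive_within A (derive_within A phi) x * c).
  by move=> Ax; apply: is_derive_withinZ; exact: h2.
split; last 1 first.
- by have [-> _] := derive_within2E H1 H2 A0; rewrite p1 mul0r.
- split.
    apply: (derive_within_C2 H1 H2) => x.
    by apply: continuousM; [exact: h3 | exact: cst_continuous].
  move=> j jN; have [q [sq qP]] := hq _ jN; exists (c *: q); split.
    exact: leq_trans (size_scale_leq _ _) sq.
  by move=> t tj; rewrite qP// hornerZ mulrC.
- by rewrite p0 mul0r.
Qed.

Lemma K_tau_h_lin d (Omega : set 'rV[R]_d) Nt tau r m (K : 'I_m -> set 'rV[R]_d) s c u v :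
  K_tau_h Omega T Nt tau r K s u -> K_tau_h Omega T Nt tau r K s v ->
  K_tau_h Omega T Nt tau r K s (c *: u + v).
Proof.
move=> [n1 [p1 [v1 [U1 V1 e1]]]] [n2 [p2 [v2 [U2 V2 e2]]]].
exists (n1 + n2)%N,
  (fun k t => match fintype.split k with inl k => p1 k t * c | inr k => p2 k t end),
  (fun k => match fintype.split k with inl k => v1 k | inr k => v2 k end); split.
- by move=> k; case: (fintype.split k) => k' //; exact: U_tau_scale.
- by move=> k; case: (fintype.split k).
- move=> t x tT Ox; rewrite !fctE e1// e2// big_split_ord /=; congr (_ + _).
    rewrite scaler_sumr; apply: eq_bigr => k _.
    by rewrite (unsplitK (inl k : _ + _)%type) /GRing.scale /= mulrA [c * _]mulrC.
  by apply: eq_bigr => k _; rewrite (unsplitK (inr k : _ + _)%type).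
Qed.

Lemma K_tau_h0 d (Omega : set 'rV[R]_d) Nt tau r m (K : 'I_m -> set 'rV[R]_d) s :
  K_tau_h Omega T Nt tau r K s 0.
Proof.
exists 0%N, (fun _ => cst 0), (fun _ => cst 0); split; try by case.
by move=> t x _ _; rewrite big_ord0.
Qed.

End C2.

Section mesh.
Variables (R : realType) (d : nat) (Omega : set 'rV[R]_d).
Hypothesis oO : open Omega.
Hypothesis bO : bounded_set Omega.
Variables (m : nat) (K : 'I_m -> set 'rV[R]_d) (s : nat).
Hypothesis cover : closure Omega = \bigcup_(j in [set: 'I_m]) K j.
Local Notation leb := (@lebesgue_rV R d).

Definition monomial (e : {ffun 'I_d -> 'I_s.+1}) (x : 'rV[R]_d) : R :=
  \prod_i x ord0 i ^+ e i.

(** As the total degree is at most s, so is every exponent: indexing by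
    ['I_s.+1] loses nothing and makes the set of indices finite. *)
Lemma mpoly_monomials (p : mpoly.mpoly d R) :
  all (fun mu => mpoly.mdeg mu <= s)%N (mpoly.msupp p) ->
  exists c : {ffun 'I_d -> 'I_s.+1} -> R, forall x : 'rV[R]_d,
    mpoly.meval (fun i => x ord0 i) p = \sum_e c e * monomial e x.
Proof.
move=> degp.
pose h mu : {ffun 'I_d -> 'I_s.+1} := [ffun i => inord (mpoly.fun_of_multinom mu i)].
exists (fun e => \sum_(mu <- mpoly.msupp p | h mu == e) mpoly.mcoeff mu p) => x.
rewrite mpoly.mevalE.
under [RHS]eq_bigr do rewrite mulr_suml.
rewrite (exchange_big_dep xpredT)//=.
elim: (mpoly.msupp p) degp => [|mu l IH] /=; first by rewrite !big_nil.
move=> /andP[mus lS]; rewrite !big_cons IH//; congr (_ + _).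
rewrite (big_pred1 (h mu))//=.
congr (_ * _); apply: eq_bigr => i _; rewrite ffunE inordK// ltnS.
apply: leq_trans mus; rewrite mpoly.mdegE (bigD1 i)//=; exact: leq_addr.
Qed.

Lemma V_h_monomials v : V_h Omega K s v ->
  exists c : 'I_m -> {ffun 'I_d -> 'I_s.+1} -> R,
  {ae leb, forall x, Omega x -> forall j, K j x -> v x = \sum_e c j e * monomial e x}.
Proof.
move=> [_ hv].
have /choice[c cP] : forall j, exists c : {ffun 'I_d -> 'I_s.+1} -> R,
    {ae leb, forall x, Omega x -> K j x -> v x = \sum_e c e * monomial e x}.
  move=> j; have [p [degp vp]] := hv j; have [c cP] := mpoly_monomials degp.
  by exists c; apply: filterS vp => x h Ox Kx; rewrite h.
exists c; have : {ae leb, forall x, forall j, Omega x -> K j x ->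
    v x = \sum_e c j e * monomial e x} by exact: filter_forall.
by apply: filterS => x h Ox j; exact: h.
Qed.

(** The finitely many cells cover Omega, and polynomials are bounded on it. *)
Lemma V_h_bounded v : V_h Omega K s v ->
  exists M : R, 0 <= M /\ {ae leb, forall x, Omega x -> `|v x| <= M}.
Proof.
move=> /V_h_monomials[c cP].
have [M [M0 MP]] := bounded_coord bO.
exists (\sum_j \sum_e `|c j e| * \prod_(i < d) M ^+ e i); split.
  apply: sumr_ge0 => j _; apply: sumr_ge0 => e _; rewrite mulr_ge0// prodr_ge0// => i _.
  by rewrite exprn_ge0.
apply: filterS cP => x h Ox.
have : closure Omega x by exact: subset_closure.
rewrite cover => -[j _ Kx]; rewrite (h Ox j Kx).
apply: le_trans (ler_norm_sum _ _ _) _.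
rewrite (bigD1 j)//= ler_wpDr//.
  apply: sumr_ge0 => k _; apply: sumr_ge0 => e _; rewrite mulr_ge0// prodr_ge0// => i _.
  by rewrite exprn_ge0.
apply: ler_sum => e _; rewrite normrM ler_wpM2l// normr_prod.
apply: ler_prod => i _; rewrite normr_ge0 normrX lerXn2r ?nnegrE//.
exact: MP.
Qed.

End mesh.

Lemma linear_dependence (R : fieldType) (I : finType) (C : 'I_#|I|.+1 -> I -> R) :
  exists c : 'I_#|I|.+1 -> R, (exists i, c i != 0) /\
    forall k, \sum_i c i * C i k = 0.
Proof.
pose M : 'M[R]_(#|I|.+1, #|I|) := \matrix_(i, k) C i (enum_val k).
have : kermx M != 0.
  rewrite kermx_eq0 /row_free neq_ltn; apply/orP; left.
  by rewrite ltnS; exact: rank_leq_col.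
case/rowV0Pn => v /sub_kermxP vM v0.
exists (fun i => v ord0 i); split.
  have [i vi] : exists i, v ord0 i != 0.
    apply/existsP; move: v0; apply: contraNT; rewrite negb_exists => /forallP h.
    by apply/eqP/rowP => i; rewrite mxE; apply/eqP; have := h i; rewrite negbK.
  by exists i.
move=> k; have /rowP/(_ (enum_rank k)) := vM; rewrite !mxE => e; rewrite -[RHS]e.
by apply: eq_bigr => i _; rewrite mxE enum_rankK.
Qed.

Section finite_dimension.
Variables (R : realType) (d : nat) (Omega : set 'rV[R]_d) (T : R).
Hypothesis oO : open Omega.
Hypothesis bO : bounded_set Omega.
Variables (m : nat) (K : 'I_m -> set 'rV[R]_d) (s : nat).
Hypothesis cover : closure Omega = \bigcup_(j in [set: 'I_m]) K j.
Variables (Nt : nat) (tau : nat -> R) (r : nat).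
Hypothesis htau : time_mesh T Nt tau.
Local Notation leb := (@lebesgue_rV R d).
Local Notation Kth := (K_tau_h Omega T Nt tau r K s).
Local Notation I := ('I_Nt * 'I_r.+3 * ('I_m * {ffun 'I_d -> 'I_s.+1}))%type.

Lemma time_mesh_cover t : 0 < t <= T -> exists j : 'I_Nt, tau j < t <= tau j.+1.
Proof.
have [t0 _ tT] := htau; move=> /andP[tp tle].
have exn : exists n, t <= tau n by exists Nt; rewrite tT.
have nP := ex_minnP exn; move: nP; case=> n tn nmin.
case: n tn nmin => [|n] tn nmin; first by move: tn; rewrite t0 leNgt tp.
have nN : (n < Nt)%N by apply: nmin; rewrite tT.
exists (Ordinal nN) => /=; rewrite tn andbT ltNge; apply/negP => /nmin.
by rewrite ltnn.
Qed.

(** Expanding the tensors: a spline is a polynomial on each time interval and an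
    element of V_h on each cell. *)
Lemma K_coefficients u : Kth u -> exists C : I -> R,
  forall t, 0 < t <= T -> {ae leb, forall x, Omega x ->
    forall (j : 'I_Nt) l, tau j < t <= tau j.+1 -> K l x ->
    u t x = \sum_a \sum_e C (j, a, (l, e)) * (t ^+ a * monomial e x)}.
Proof.
move=> [n [phi [v [Uphi Vv uE]]]].
have /choice[q qP] : forall k, exists q : 'I_Nt -> {poly R},
    forall j : 'I_Nt, (size (q j) <= r.+3)%N /\
    forall t, tau j < t <= tau j.+1 -> phi k t = (q j).[t].
  move=> k; have [[_ h] _ _] := Uphi k.
  have /choice[q qP] := fun j : 'I_Nt => h j (ltn_ord j).
  by exists q => j; exact: qP.
have /choice[c cP] := fun k => V_h_monomials (Vv k).
exists (fun i : I => \sum_k (q k i.1.1)`_i.1.2 * c k i.2.1 i.2.2) => t /andP[t0 tT].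
have : {ae leb, forall x, forall k, Omega x -> forall j, K j x ->
  v k x = \sum_e c k j e * monomial e x} by exact: filter_forall.
apply: filterS => x h Ox j l tj Kx.
rewrite uE//; last by rewrite tT ltW.
under eq_bigr => k _.
  have [sq qE] := qP k j.
  rewrite (h k Ox l Kx) qE// (horner_coef_wide _ sq) mulr_suml.
  under eq_bigr do rewrite mulr_sumr.
  over.
rewrite exchange_big; apply: eq_bigr => a _.
rewrite exchange_big; apply: eq_bigr => e _ /=.
by rewrite mulr_suml; apply: eq_bigr => k _; ring.
Qed.

(** More elements than coefficients: some combination has all its coefficients
    zero, and the time intervals and the cells cover everything. *)
Lemma K_dependent (e : 'I_#|{: I}|.+1 -> R -> 'rV[R]_d -> R) :
  (forall i, Kth (e i)) ->
  exists c : 'I_#|{: I}|.+1 -> R, (exists i, c i != 0) /\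
    forall t, 0 < t <= T -> {ae leb, forall x, Omega x -> (\sum_i c i *: e i) t x = 0}.
Proof.
move=> Ke.
have /choice[C CP] := fun i => K_coefficients (Ke i).
have [c [c0 cC]] := linear_dependence C.
exists c; split => // t tT.
have : {ae leb, forall x, forall i, Omega x ->
    forall (j : 'I_Nt) l, tau j < t <= tau j.+1 -> K l x ->
    e i t x = \sum_a \sum_mu C i (j, a, (l, mu)) * (t ^+ a * monomial mu x)}.
  by apply: filter_forall => i; exact: CP.
apply: filterS => x h Ox.
have [j tj] := time_mesh_cover tT.
have : closure Omega x by exact: subset_closure.
rewrite cover => -[l _ Kx].
rewrite !fct_sumE.
under eq_bigr => i _.
  rewrite !fctE (h i Ox j l tj Kx) /GRing.scale /= mulr_sumr.
  under eq_bigr do rewrite mulr_sumr.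
  over.
rewrite exchange_big big1//= => a _.
rewrite exchange_big big1//= => mu _.
under eq_bigr do rewrite mulrA.
by rewrite -mulr_suml cC mul0r.
Qed.

End finite_dimension.

(** * Time integrals *)

Section bounded_multiplier.
Context dp (X : measurableType dp) (R : realType) (mu : {measure set X -> \bar R}).
Variable D : set X.
Hypothesis mD : measurable D.
Implicit Types F G : X -> R.

Lemma ae_int_mul G F B : measurable_fun D G -> (forall x, D x -> `|G x| <= B) ->
  ae_int mu D F -> ae_int mu D (fun x => G x * F x).
Proof.
move=> mG GB [H [iH FH]]; exists (fun x => G x * H x); split; last first.
  by apply: filterS FH => x h /h ->.
have iBH : mu.-integrable D (fun x => (B%:E * (EFin \o H) x)%E) by exact: integrableZl.
apply: le_integrable iBH => //.
  apply/measurable_EFinP/measurable_funM => //.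
  by apply/measurable_EFinP; exact: measurable_int iH.
move=> x Dx /=; rewrite lee_fin !normrM ler_wpM2r//.
by apply: le_trans (GB _ Dx) _; exact: ler_norm.
Qed.

(** Truncating F by the absolute value of H makes the domination hold
    everywhere, and changes F on a null set only. *)
Lemma ae_int_dominated F H : measurable_fun D F -> mu.-integrable D (EFin \o H) ->
  {ae mu, forall x, D x -> `|F x| <= H x} -> ae_int mu D F.
Proof.
move=> mF iH FH.
have mH : measurable_fun D H by apply/measurable_EFinP; exact: measurable_int iH.
pose G x := Num.max (- `|H x|) (Num.min `|H x| (F x)).
exists G; split; last first.
  apply: filterS FH => x h /h FH; rewrite /G.
  have /andP[h1 h2] : - `|H x| <= F x <= `|H x|.
    by rewrite -ler_norml (le_trans FH)// ler_norm.
  by rewrite min_r// max_r.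
have mnH : measurable_fun D (fun x => `|H x|) by exact: measurableT_comp.
apply: le_integrable iH => //.
  apply/measurable_EFinP; apply: measurable_maxr; first exact: measurableT_comp.
  exact: measurable_minr.
move=> x _ /=; rewrite lee_fin.
rewrite /G ler_norml le_max lexx/= ge_max ge_min lexx andbT.
by rewrite ge0_cp// oppr_le0.
Qed.

Lemma ae_int_bounded F B : (mu D < +oo)%E -> measurable_fun D F ->
  {ae mu, forall x, D x -> `|F x| <= B} -> ae_int mu D F.
Proof.
move=> fD mF; apply: (ae_int_dominated (H := cst B)) => //.
apply: (@measurable_bounded_integrable _ _ _ mu (cst B) D mD fD) => //.
by exists `|B|; split => // M BM x _; exact: ltW.
Qed.

End bounded_multiplier.

Section time_integral.
Variables (R : realType) (T eps : R).
Hypothesis T0 : 0 < T.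
Hypothesis e0 : 0 < eps.
Local Notation A := (`[0, T]%classic : set R).
Local Notation D := (`]0, T[%classic : set R).
Local Notation lam := (@lebesgue_measure R).
Implicit Types F G phi : R -> R.

Lemma ae_lamS (P Q : R -> Prop) : (forall t, P t -> Q t) ->
  {ae lam, forall t, P t} -> {ae lam, forall t, Q t}.
Proof. exact: (@filterS _ _ (ae_filter_ringOfSetsType lam)). Qed.

Lemma ae_lamS2 (P Q S : R -> Prop) : (forall t, P t -> Q t -> S t) ->
  {ae lam, forall t, P t} -> {ae lam, forall t, Q t} -> {ae lam, forall t, S t}.
Proof. exact: (@filterS2 _ _ (ae_filter_ringOfSetsType lam)). Qed.

Lemma subset_oo_cc : D `<=` A.
Proof. by move=> t; rewrite /= !in_itv/= => /andP[? ?]; rewrite !ltW. Qed.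

Lemma continuous_seg_measurable phi : {within A, continuous phi} -> measurable_fun A phi.
Proof. by move=> c; apply: subspace_continuous_measurable_fun. Qed.

Lemma continuous_D_measurable phi : {within A, continuous phi} -> measurable_fun D phi.
Proof.
move=> /continuous_seg_measurable; apply: measurable_funS; last exact: subset_oo_cc.
exact: measurable_itv.
Qed.

Lemma continuous_seg_bounded phi : {within A, continuous phi} ->
  exists B : R, 0 <= B /\ forall t, A t -> `|phi t| <= B.
Proof.
move=> c; have : compact (phi @` A) by apply: continuous_compact => //; exact: segment_compact.
move=> /compact_bounded [N [Nr NP]]; exists (`|N| + 1); split; first by rewrite addr_ge0.
move=> t At; apply: NP; last by exists t.
by have := ler_norm N; lra.
Qed.

Lemma lebesgue_D : (lam D < +oo)%E.
Proof. by rewrite lebesgue_measure_itv/= lte_fin T0 sube0 ltry. Qed.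

Lemma ae_int_continuous phi : {within A, continuous phi} -> ae_int lam D phi.
Proof.
move=> c; have [B [_ BP]] := continuous_seg_bounded c.
apply: (@ae_int_bounded _ _ _ lam D _ phi B) => //.
- exact: lebesgue_D.
- exact: continuous_D_measurable.
- by apply: aeW => t /subset_oo_cc; exact: BP.
Qed.

(** An interval of positive length is not negligible. *)
Lemma continuous_ae0 phi : {within A, continuous phi} ->
  {ae lam, forall t, D t -> phi t = 0} -> forall t, D t -> phi t = 0.
Proof.
move=> c [N [mN N0 sub]] t Dt; apply: contrapT => pt.
have At := subset_oo_cc Dt.
have ct : {for t, continuous phi}.
  have := continuous_subspaceW subset_oo_cc c; rewrite continuous_open_subspace//.
  by apply; rewrite inE.
have near0 : \forall x \near t, phi x != 0.
  have : nbhs (phi t) [set y | y != 0].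
    by apply: open_nbhs_nbhs; split; [exact: open_neq | exact/eqP].
  by move=> /ct.
have nearD : \forall x \near t, D x.
  by apply: open_nbhs_nbhs; split => //; exact: interval_open.
have : nbhs t ([set x | phi x != 0] `&` D) by exact: filterI.
move=> /nbhs_ballP[e /= ep eP].
have : (lam `](t - e)%R, (t + e)%R[%classic <= lam N)%E.
  apply: le_measure; rewrite ?inE//.
  move=> x /=; rewrite in_itv/= => /andP[x1 x2]; apply: sub => /= h.
  have [] := eP x; first by rewrite /ball /= ltr_norml; apply/andP; split; lra.
  by move=> /eqP px Dx; apply: px; exact: h.
rewrite N0 lebesgue_measure_itv/= lte_fin ifT; last by lra.
rewrite -EFinB lee_fin; lra.
Qed.

Lemma weight_continuous : {within A, continuous (fun t : R => expR (- t / eps))}.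
Proof.
apply: continuous_subspaceT => t.
apply: (@continuous_comp _ _ _ (fun t : R => - t / eps) expR); last exact: continuous_expR.
by apply: cvgM; [apply: cvgN; exact: cvg_id | exact: cvg_cst].
Qed.

Lemma ae_int_weight F : ae_int lam D F -> ae_int lam D (fun t => expR (- t / eps) * F t).
Proof.
have [B [_ BP]] := continuous_seg_bounded weight_continuous.
apply: ae_int_mul => //.
  exact: continuous_D_measurable weight_continuous.
by move=> t /subset_oo_cc; exact: BP.
Qed.

Lemma ae_int_continuous_mul phi F : {within A, continuous phi} -> ae_int lam D F ->
  ae_int lam D (fun t => phi t * F t).
Proof.
move=> c; have [B [_ BP]] := continuous_seg_bounded c; apply: ae_int_mul => //.
  exact: continuous_D_measurable.
by move=> t /subset_oo_cc; exact: BP.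
Qed.

Local Notation wint := (wint T eps).

Lemma wint_lin c F G : ae_int lam D F -> ae_int lam D G ->
  wint (fun t => c * F t + G t) = c * wint F + wint G.
Proof.
move=> iF iG; rewrite /wint -Rint_lin//; try exact: ae_int_weight.
by apply: eq_Rintegral => t _; ring.
Qed.

Lemma wintD F G : ae_int lam D F -> ae_int lam D G ->
  wint (fun t => F t + G t) = wint F + wint G.
Proof.
move=> iF iG; rewrite -[wint F]mul1r -wint_lin//.
by apply: eq_Rintegral => t _; rewrite mul1r.
Qed.

Lemma eq_wint F G : {ae lam, forall t, D t -> F t = G t} -> wint F = wint G.
Proof.
move=> FG; rewrite /wint; apply: (@ae_eq_lower_Rintegral _ _ _ lam).
by apply: ae_lamS FG => t h Dt; rewrite h.
Qed.

Lemma wint0 : wint (cst 0) = 0.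
Proof.
rewrite /wint; under eq_Rintegral do rewrite mulr0.
by rewrite Rintegral_cst// mul0r.
Qed.

Lemma wint_le F G : ae_int lam D F -> ae_int lam D G ->
  (forall t, D t -> F t <= G t) -> wint F <= wint G.
Proof.
move=> iF iG FG; apply: Rint_le => //; try exact: ae_int_weight.
by apply: aeW => t Dt; rewrite ler_wpM2l ?expR_ge0//; exact: FG.
Qed.

Lemma wint_ge0 F : (forall t, D t -> 0 <= F t) -> 0 <= wint F.
Proof.
by move=> F0; apply: Rint_ge0 => //; apply: aeW => t Dt; rewrite mulr_ge0 ?expR_ge0//; exact: F0.
Qed.

Lemma wint_eq0 F : ae_int lam D F -> (forall t, D t -> 0 <= F t) -> wint F = 0 ->
  {ae lam, forall t, D t -> F t = 0}.
Proof.
move=> iF F0 wF.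
have : {ae lam, forall t, D t -> expR (- t / eps) * F t = 0}.
  apply: Rint_eq0 => //; first exact: ae_int_weight.
  by apply: aeW => t Dt; rewrite mulr_ge0 ?expR_ge0//; exact: F0.
by apply: ae_lamS => t h /h /eqP; rewrite mulf_eq0 gt_eqF ?expR_gt0//= => /eqP.
Qed.

End time_integral.

(** * Bounded functions of space and time *)

Section space_time.
Variables (R : realType) (d : nat) (Omega : set 'rV[R]_d) (T : R).
Hypothesis oO : open Omega.
Hypothesis bO : bounded_set Omega.
Hypothesis T0 : 0 < T.
Local Notation leb := (@lebesgue_rV R d).
Local Notation lam := (@lebesgue_measure R).
Local Notation A := (`[0, T]%classic : set R).
Local Notation D := (`]0, T[%classic : set R).

Let mO : measurable Omega := measurable_open oO.
Let fO : (leb Omega < +oo)%E := lebesgue_bounded oO bO.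

(** Bounded on ]0, T[ x Omega and jointly measurable, both up to a null set of
    Omega that may depend on the time. *)
Definition st_bounded (g : R -> 'rV[R]_d -> R) := exists (h : R * 'rV[R]_d -> R) (M : R),
  [/\ measurable_fun setT h, 0 <= M,
      forall t, D t -> {ae leb, forall x, Omega x -> g t x = h (t, x)} &
      forall t, D t -> {ae leb, forall x, Omega x -> `|h (t, x)| <= M}].

Lemma measurable_section (h : R * 'rV[R]_d -> R) t : measurable_fun setT h ->
  measurable_fun Omega (fun x => h (t, x)).
Proof.
move=> mh; apply: measurable_funTS.
exact: (measurableT_comp mh (measurable_pair1 t)).
Qed.

Lemma st_bounded_bound g : st_bounded g -> exists M : R, 0 <= M /\
  forall t, D t -> {ae leb, forall x, Omega x -> `|g t x| <= M}.
Proof.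
move=> [h [M [mh M0 gh hM]]]; exists M; split => // t Dt.
by apply: filterS2 (gh t Dt) (hM t Dt) => x h1 h2 Ox; rewrite h1// h2.
Qed.

Lemma st_bounded_space g t : st_bounded g -> D t -> ae_int leb Omega (g t).
Proof.
move=> [h [M [mh M0 gh hM]]] Dt.
apply: (@eq_ae_int _ _ _ leb Omega (fun x => h (t, x))).
  by apply: filterS (gh t Dt) => x e Ox; rewrite e.
by apply: (ae_int_bounded mO fO _ (hM t Dt)); exact: measurable_section.
Qed.

(** Measurability in time is part of Tonelli's theorem, applied to the positive
    and the negative parts. *)
Lemma st_bounded_time g : st_bounded g -> ae_int lam D (fun t => \int[leb]_(x in Omega) g t x).
Proof.
move=> [h [M [mh M0 gh hM]]].
apply: (@eq_ae_int _ _ _ lam D (fun t => \int[leb]_(x in Omega) h (t, x))).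
  apply: aeW => t Dt; apply: ae_eq_lower_Rintegral.
  by apply: filterS (gh t Dt) => x e Ox; rewrite e.
pose h1 (z : R * 'rV[R]_d) := (h z * \1_Omega z.2)%:E.
have mh1 : measurable_fun setT h1.
  apply/measurable_EFinP/measurable_funM => //.
  exact: (measurableT_comp (measurable_indic mO) measurable_snd).
have hE t : \int[leb]_(x in Omega) h (t, x) = fine (
    (\int[leb]_x (h1 ^\+ (t, x))%E) - (\int[leb]_x (h1 ^\- (t, x))%E))%E.
  rewrite /Rintegral integral_mkcond integralE; congr fine.
  congr (_ - _)%E; apply: eq_integral => x _; rewrite ?funeposE ?funenegE /h1 /patch indicE /=;
    by case: ifP; rewrite ?mulr1 ?mulr0.
apply: (@ae_int_bounded _ _ _ lam D _ _ (M * fine (leb Omega))).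
- exact: measurable_itv.
- exact: lebesgue_D.
- apply: measurable_funTS; rewrite (funext hE).
  apply: (measurableT_comp (f := fine)) => //.
  apply: emeasurable_funB.
  + apply: (@measurable_fun_fubini_tonelli_F _ _ _ _ _ leb (h1 ^\+)%E).
      exact: measurable_funepos.
    by move=> z; exact: funepos_ge0.
  + apply: (@measurable_fun_fubini_tonelli_F _ _ _ _ _ leb (h1 ^\-)%E).
      exact: measurable_funeneg.
    by move=> z; exact: funeneg_ge0.
- apply: aeW => t Dt.
  have ih : ae_int leb Omega (fun x => h (t, x)).
    by apply: (ae_int_bounded mO fO _ (hM t Dt)); exact: measurable_section.
  have icst c : ae_int leb Omega (cst c).
    apply: (@ae_int_bounded _ _ _ leb Omega mO (cst c) `|c| fO) => //.
    exact: aeW.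
  rewrite ler_norml -mulNr -!Rintegral_cst//; apply/andP; split.
    apply: (Rint_le mO (icst _) ih); apply: filterS (hM t Dt) => x e /e.
    by rewrite ler_norml => /andP[].
  apply: (Rint_le mO ih (icst _)); apply: filterS (hM t Dt) => x e /e.
  by rewrite ler_norml => /andP[].
Qed.

Lemma st_bounded_comp2 (F : R -> R -> R) g1 g2 B : st_bounded g1 -> st_bounded g2 ->
  measurable_fun setT (fun z : R * R => F z.1 z.2) ->
  (forall M x y, 0 <= M -> `|x| <= M -> `|y| <= M -> `|F x y| <= B M) ->
  st_bounded (fun t x => F (g1 t x) (g2 t x)).
Proof.
move=> [h1 [M1 [mh1 M10 gh1 hM1]]] [h2 [M2 [mh2 M20 gh2 hM2]]] mF FB.
have M0 : 0 <= M1 + M2 by rewrite addr_ge0.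
exists (fun z => F (h1 z) (h2 z)), (`|B (M1 + M2)|); split => //.
- have := measurableT_comp mF (measurable_fun_pair mh1 mh2); exact.
- by move=> t Dt; apply: filterS2 (gh1 t Dt) (gh2 t Dt) => x e1 e2 Ox; rewrite e1// e2.
- move=> t Dt; apply: filterS2 (hM1 t Dt) (hM2 t Dt) => x e1 e2 Ox.
  apply: le_trans (ler_norm _); apply: FB => //.
    by apply: le_trans (e1 Ox) _; rewrite lerDl.
  by apply: le_trans (e2 Ox) _; rewrite lerDr.
Qed.

Lemma st_bounded_tensor n (phi : 'I_n -> R -> R) (v : 'I_n -> 'rV[R]_d -> R) :
  (forall k, {within A, continuous (phi k)}) ->
  (forall k, measurable_fun Omega (v k)) ->
  (forall k, exists M : R, 0 <= M /\ {ae leb, forall x, Omega x -> `|v k x| <= M}) ->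
  st_bounded (fun t x => \sum_k phi k t * v k x).
Proof.
move=> cphi mv /choice[M MP].
have /choice[B BP] := fun k => continuous_seg_bounded (cphi k).
exists (fun z => \sum_k (phi k \_ A) z.1 * (v k \_ Omega) z.2), (\sum_k B k * M k).
split.
- apply: measurable_sum => k; apply: measurable_funM.
    apply: measurableT_comp; last exact: measurable_fst.
    apply/(measurable_restrictT _ _).1; first exact: measurable_itv.
    exact: continuous_seg_measurable.
  apply: measurableT_comp; last exact: measurable_snd.
  by apply/(measurable_restrictT _ _).1.
- by apply: sumr_ge0 => k _; rewrite mulr_ge0//; [have [] := BP k | have [] := MP k].
- move=> t Dt; apply: aeW => x Ox; apply: eq_bigr => k _ /=.
  by rewrite !patchE !mem_set//; exact: subset_oo_cc.
- move=> t Dt.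
  have : {ae leb, forall x, forall k, Omega x -> `|v k x| <= M k}.
    by apply: filter_forall => k; have [] := MP k.
  apply: filterS => x h Ox; apply: le_trans (ler_norm_sum _ _ _) _.
  apply: ler_sum => k _ /=; rewrite !patchE !mem_set//; last exact: subset_oo_cc.
  by rewrite normrM ler_pM//; [have [_] := BP k; apply; exact: subset_oo_cc | exact: h].
Qed.

Lemma eq_st_bounded g g' : (forall t, D t -> {ae leb, forall x, Omega x -> g t x = g' t x}) ->
  st_bounded g -> st_bounded g'.
Proof.
move=> e [h [M [mh M0 gh hM]]]; exists h, M; split => // t Dt.
by apply: filterS2 (e t Dt) (gh t Dt) => x h1 h2 Ox; rewrite -h1// h2.
Qed.

End space_time.

(** * The load term *)

Section bochner.
Variables (R : realType) (d : nat) (Omega : set 'rV[R]_d) (T : R).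
Hypothesis mO : measurable Omega.
Hypothesis T0 : 0 < T.
Local Notation leb := (@lebesgue_rV R d).
Local Notation lam := (@lebesgue_measure R).
Local Notation D := (`]0, T[%classic : set R).
Local Notation L2 := (L2 Omega).
Local Notation L2ip := (L2ip Omega).

(** The functions are set to 0 where convergence fails, so that the limit exists
    everywhere. *)
Lemma ae_limit_measurable (F_ : nat -> R -> R) (F : R -> R) :
  (forall n, measurable_fun setT (F_ n)) ->
  {ae lam, forall t, D t -> F_ n t @[n --> \oo] --> F t} ->
  exists G : R -> R, measurable_fun setT G /\ {ae lam, forall t, D t -> F t = G t}.
Proof.
move=> mF [N [mN N0 sub]].
have mDN : measurable (D `\` N) by apply: measurableD => //; exact: measurable_itv.
exists (F \_ (D `\` N)); split; last first.
  exists N; split => // t /= ne; apply: contrapT => tN; apply: ne => Dt.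
  by rewrite patchE mem_set.
apply: (@measurable_fun_cvg _ _ _ _ (fun n => F_ n \_ (D `\` N))).
  move=> n; apply/(measurable_restrictT _ _).1 => //.
  exact: measurable_funTS.
move=> t _; rewrite /patch; case: ifPn => [|_]; last exact: cvg_cst.
rewrite inE => -[Dt tN]; apply: contrapT => h; apply: tN; apply: sub => /= h'.
exact/h/h'.
Qed.

Lemma sq_cvg0 (x e : nat -> R) c : (forall n, x n ^+ 2 <= e n * c) ->
  e @ \oo --> 0 -> x @ \oo --> 0.
Proof.
move=> xe e0; apply/cvgr0Pnorm_lt => r r0.
have h : (fun n => e n * c) @ \oo --> (0 : R).
  by rewrite -(mul0r c); apply: cvgM => //; exact: cvg_cst.
have r2 : 0 < r ^+ 2 by rewrite exprn_gt0.
have H : \forall n \near \oo, `|e n * c| < r ^+ 2 by move/cvgr0Pnorm_lt : h; exact.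
near=> n; have hn : `|e n * c| < r ^+ 2 by near: n.
rewrite -(ltr_pXn2r (n := 2)) ?nnegrE ?(ltW r0)// real_normK ?num_real//.
apply: le_lt_trans (xe n) _; apply: le_lt_trans (ler_norm _) hn.
Unshelve. all: by end_near.
Qed.

Variable f : R -> 'rV[R]_d -> R.
Hypothesis hf : bochner_L2 Omega T f.

(** The pairings of the approximating simple functions with v are measurable and
    converge almost everywhere, and so do their squared norms; hence the pairing
    and the squared norm of f are almost everywhere equal to measurable
    functions. The latter is integrable, and with the squared norm of v it
    dominates the former. *)
Lemma bochner_ae_int v : L2 v -> ae_int lam D (fun t => L2ip (f t) v).
Proof.
move=> Lv; have [Lf' [s [sS sC]] fin] := hf.
have Lf t : D t -> L2 (f t) by rewrite /= in_itv/=; exact: Lf'.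
have {sC} sC : {ae lam, forall t, D t ->
    (fun n => L2ip (fun x => s n t x - f t x) (fun x => s n t x - f t x)) @ \oo --> (0 : R)}.
  by apply: ae_lamS sC => t h; rewrite /= in_itv/=; exact: h.
have sE n t : exists m (A : 'I_m -> set R) (g : 'I_m -> 'rV[R]_d -> R),
    [/\ forall k, measurable (A k), forall k, L2 (g k) &
    s n t = fun x => \sum_k \1_(A k) t * g k x].
  have [m [A [g [mA Lg e]]]] := sS n; exists m, A, g; split => //.
  exact/funext.
have Ls n t : L2 (s n t) by have [m [A [g [_ Lg ->]]]] := sE n t; exact: L2_sum.
have L2B u w : L2 u -> L2 w -> L2 (fun x => u x - w x).
  move=> Lu Lw; have := L2_lin mO (-1) Lw Lu.
  by under eq_fun do rewrite mulN1r addrC.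
have ipB u w z : L2 u -> L2 w -> L2 z ->
    L2ip (fun x => u x - w x) z = L2ip u z - L2ip w z.
  move=> Lu Lw Lz; have := L2ip_lin mO (-1) Lw Lu Lz; rewrite mulN1r addrC => <-.
  by apply: eq_Rintegral => x _; rewrite mulN1r [- _ + _]addrC.
have cvg_ip t w : D t -> L2 w ->
    (fun n => L2ip (fun x => s n t x - f t x) (fun x => s n t x - f t x)) @ \oo --> (0 : R) ->
    L2ip (s n t) w @[n --> \oo] --> L2ip (f t) w.
  move=> Dt Lw h; apply/subr_cvg0.
  have Lft := Lf t Dt.
  rewrite (_ : (fun n => _) = (fun n => L2ip (fun x => s n t x - f t x) w)); last first.
    by apply/funext => n; rewrite ipB.
  apply: sq_cvg0 h => n; apply: L2ip_cauchy_schwarz => //.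
  exact: L2B.
have mip n w : L2 w -> measurable_fun setT (fun t => L2ip (s n t) w).
  move=> Lw; have [m [A [g [mA Lg e]]]] := sS n.
  rewrite (_ : (fun t => _) = fun t => \sum_k \1_(A k) t * L2ip (g k) w).
    by apply: measurable_sum => k; apply: measurable_funM => //; exact: measurable_indic.
  by apply/funext => t; rewrite (funext (e t)) L2ip_sum.
have mipp n : measurable_fun setT (fun t => L2ip (s n t) (s n t)).
  have [m [A [g [mA Lg e]]]] := sS n.
  rewrite (_ : (fun t => _) = fun t => \sum_k \1_(A k) t * L2ip (s n t) (g k)).
    by apply: measurable_sum => k; apply: measurable_funM => //; exact: mip.
  apply/funext => t; rewrite {1}(funext (e t)) L2ip_sum//.
  by apply: eq_bigr => k _; rewrite L2ipC.
have [G [mG fG]] : exists G : R -> R, measurable_fun setT G /\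
    {ae lam, forall t, D t -> L2ip (f t) v = G t}.
  apply: (ae_limit_measurable (fun n => mip n v Lv)).
  by apply: ae_lamS sC => t h Dt; apply: cvg_ip => //; exact: h.
have [S [mS fS]] : exists S : R -> R, measurable_fun setT S /\
    {ae lam, forall t, D t -> L2ip (f t) (f t) = S t}.
  apply: (ae_limit_measurable mipp).
  apply: ae_lamS sC => t h Dt; have {}h := h Dt.
  have Lft := Lf t Dt.
  have h1 := cvg_ip t (f t) Dt Lft h.
  have : (fun n => L2ip (fun x => s n t x - f t x) (fun x => s n t x - f t x) +
      2 * L2ip (s n t) (f t) - L2ip (f t) (f t)) @ \oo -->
      0 + 2 * L2ip (f t) (f t) - L2ip (f t) (f t).
    apply: cvgB; last exact: cvg_cst.
    by apply: cvgD => //; apply: cvgM => //; exact: cvg_cst.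
  have -> : 0 + 2 * L2ip (f t) (f t) - L2ip (f t) (f t) = L2ip (f t) (f t) by ring.
  apply: cvg_trans; apply: near_eq_cvg; apply: nearW => n /=.
  have Lsf := L2B _ _ (Ls n t) Lft.
  rewrite ipB// (L2ipC _ (s n t) (fun x => _ - _)) (L2ipC _ (f t) (fun x => _ - _)).
  rewrite !ipB// (L2ipC _ (f t) (s n t)).
  ring.
have iS : lam.-integrable D (EFin \o S).
  apply/integrableP; split; first by apply/measurable_EFinP; exact: measurable_funTS.
  rewrite (_ : (\int[lam]_(x in D) `|(EFin \o S) x|)%E =
     (\int[lam]_(t in D) (L2ip (f t) (f t))%:E)%E) //.
  apply: ae_eq_lower_integral; apply: ae_lamS fS => t h /h e.
  by rewrite /= -e ger0_norm// L2ip_ge0.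
apply: (@eq_ae_int _ _ _ lam D G); first by apply: ae_lamS fG => t h /h.
apply: (@ae_int_dominated _ _ _ lam D _ G (fun t => S t + L2ip v v)).
- exact: measurable_itv.
- exact: measurable_funTS.
- rewrite (_ : EFin \o _ = (fun t => (EFin \o S) t + (EFin \o cst (L2ip v v)) t)%E)//.
  apply: integrableD => //.
  apply: (@measurable_bounded_integrable _ _ _ lam (cst (L2ip v v)) D) => //.
    exact: lebesgue_D.
  by exists `|L2ip v v|; split => // M vM x _; exact: ltW.
- apply: ae_lamS2 fG fS => t h1 h2 Dt; rewrite -h1// -h2//.
  have := L2ip_cauchy_schwarz mO (Lf t Dt) Lv.
  have := L2ip_ge0 Omega (f t); have := L2ip_ge0 Omega v.
  set a := L2ip _ _; set b := L2ip _ _; set x := L2ip _ _ => b0 a0 h.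
  rewrite -(ler_pXn2r (n := 2)) ?nnegrE ?addr_ge0// real_normK ?num_real//; nra.
Qed.

End bochner.

(** * The forms on the discrete space *)

Section forms_on_K.
Variables (R : realType) (d : nat) (Omega : set 'rV[R]_d) (T eps p : R).
Hypothesis oO : open Omega.
Hypothesis bO : bounded_set Omega.
Hypothesis T0 : 0 < T.
Hypothesis e0 : 0 < eps.
Hypothesis p_val : p = 0 \/ 2 <= p.
Variable f : R -> 'rV[R]_d -> R.
Hypothesis hf : bochner_L2 Omega T f.
Variables (m : nat) (K : 'I_m -> set 'rV[R]_d) (s : nat).
Hypothesis cover : closure Omega = \bigcup_(j in [set: 'I_m]) K j.
Variables (Nt : nat) (tau : nat -> R) (r : nat).
Local Notation leb := (@lebesgue_rV R d).
Local Notation lam := (@lebesgue_measure R).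
Local Notation A := (`[0, T]%classic : set R).
Local Notation D := (`]0, T[%classic : set R).
Local Notation Kth := (K_tau_h Omega T Nt tau r K s).
Local Notation L2 := (L2 Omega).
Local Notation L2ip := (L2ip Omega).
Local Notation L2ipV := (L2ipV Omega).
Local Notation grad := (grad Omega).
Local Notation dtt := (dtt T).
Local Notation wint := (wint T eps).
Implicit Types u v w z : R -> 'rV[R]_d -> R.

Let mO : measurable Omega := measurable_open oO.
Let fO : (leb Omega < +oo)%E := lebesgue_bounded oO bO.

Definition C2_data (phi phi1 phi2 : R -> R) :=
  [/\ forall x, A x -> is_derive_within T phi x (phi1 x),
      forall x, A x -> is_derive_within T phi1 x (phi2 x),
      {within A, continuous phi2}, phi 0 = 0 & phi1 0 = 0].

Lemma A0 : A 0.
Proof. by rewrite /= in_itv/= lexx ltW. Qed.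

Lemma C2_data_continuous phi phi1 phi2 : C2_data phi phi1 phi2 ->
  {within A, continuous phi}.
Proof. by move=> [h _ _ _ _]; exact: is_derive_within_continuous h. Qed.

Lemma V_h_L2 (v : 'rV[R]_d -> R) : V_h Omega K s v -> L2 v.
Proof. by move=> [[[]]]. Qed.

Lemma eq_L2 (v w : 'rV[R]_d -> R) : (forall x, Omega x -> v x = w x) -> L2 v -> L2 w.
Proof.
move=> e [mv iv]; split.
  by apply: eq_measurable_fun mv => x; rewrite inE => /e.
rewrite (eq_integral (fun x => (v x ^+ 2)%:E))// => x; rewrite inE => Ox.
by rewrite e.
Qed.

(** Time derivatives and weak gradients of a sum of tensors are computed
    termwise. *)
Lemma K_structure u : Kth u -> exists n (phi phi1 phi2 : 'I_n -> R -> R)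
    (v : 'I_n -> 'rV[R]_d -> R),
  [/\ forall k, C2_data (phi k) (phi1 k) (phi2 k),
      forall k, V_h Omega K s (v k),
      forall t x, A t -> Omega x -> u t x = \sum_k phi k t * v k x,
      forall t x, A t -> Omega x ->
        is_derive_within T (u ^~ x) t (\sum_k phi1 k t * v k x) /\
        is_derive_within T (fun t => \sum_k phi1 k t * v k x) t (\sum_k phi2 k t * v k x) &
      forall t, A t -> is_weak_grad Omega (u t) (fun x => \sum_k phi k t *: grad (v k) x) ].
Proof.
move=> [n [phi [v [Uphi Vv uE]]]].
exists n, phi, (fun k => derive_within A (phi k)),
  (fun k => derive_within A (derive_within A (phi k))), v.
have uE' t x : A t -> Omega x -> u t x = \sum_k phi k t * v k x.
  by rewrite /= in_itv/=; exact: uE.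
have Cphi k : C2_data (phi k) (derive_within A (phi k))
    (derive_within A (derive_within A (phi k))).
  by have [[[h1 h2 h3] _] p0 p1] := Uphi k.
split => // [t x At Ox|t At].
  split.
    apply: (@eq_is_derive_within _ _ (fun t => \sum_k phi k t * v k x)) => //.
      by move=> y Ay; rewrite uE'.
    by apply: is_derive_within_sum => k; have [h _ _ _ _] := Cphi k; exact: h.
  by apply: is_derive_within_sum => k; have [_ h _ _ _] := Cphi k; exact: h.
apply: (@weak_grad_ext _ _ _ (fun x => \sum_k phi k t * v k x)).
  by apply: aeW => x Ox; rewrite uE'.
apply: weak_grad_sum => // k; first exact: V_h_L2.
by apply: gradP; have [[]] := Vv k.
Qed.

Lemma K_slice u x : Kth u -> Omega x -> exists u1 : R -> R, forall t, A t ->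
  is_derive_within T (u ^~ x) t (u1 t) /\ is_derive_within T u1 t (dtt u t x).
Proof.
move=> Ku Ox; have [n [phi [phi1 [phi2 [v [Cphi Vv uE uD _]]]]]] := K_structure Ku.
exists (fun t => \sum_k phi1 k t * v k x) => t At.
have h1 y : A y -> _ := fun Ay => (uD y x Ay Ox).1.
have h2 y : A y -> _ := fun Ay => (uD y x Ay Ox).2.
have [_ [_ e]] := derive_within2E T0 h1 h2 At.
split; first exact: h1.
by rewrite /Defs.dtt e; exact: h2.
Qed.

Lemma dtt_lin c u v t x : Kth u -> Kth v -> A t -> Omega x ->
  dtt (c *: u + v) t x = c * dtt u t x + dtt v t x.
Proof.
move=> Ku Kv At Ox.
have [u1 uP] := K_slice Ku Ox; have [v1 vP] := K_slice Kv Ox.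
have h1 y : A y -> is_derive_within T ((c *: u + v) ^~ x) y (u1 y * c + v1 y).
  move=> Ay; have := is_derive_withinD (is_derive_withinZ (c := c) (uP y Ay).1) (vP y Ay).1.
  apply: eq_is_derive_within => // z _; rewrite !fctE /GRing.scale /= mulrC //.
have h2 y : A y -> is_derive_within T (fun y => u1 y * c + v1 y) y (dtt u y x * c + dtt v y x).
  by move=> Ay; exact: is_derive_withinD (is_derive_withinZ (c := c) (uP y Ay).2) (vP y Ay).2.
by have [_ [_]] := derive_within2E T0 h1 h2 At; rewrite /Defs.dtt => ->; rewrite mulrC.
Qed.

Lemma dtt_sum u n phi1 phi2 (v : 'I_n -> 'rV[R]_d -> R) t x :
  (forall t x, A t -> Omega x ->
     is_derive_within T (u ^~ x) t (\sum_(k < n) phi1 k t * v k x) /\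
     is_derive_within T (fun t => \sum_k phi1 k t * v k x) t (\sum_k phi2 k t * v k x)) ->
  A t -> Omega x -> dtt u t x = \sum_k phi2 k t * v k x.
Proof.
move=> uD At Ox.
have h1 y : A y -> _ := fun Ay => (uD y x Ay Ox).1.
have h2 y : A y -> _ := fun Ay => (uD y x Ay Ox).2.
by have [_ [_ ]] := derive_within2E T0 h1 h2 At.
Qed.

Lemma K_L2 u t : Kth u -> A t -> L2 (u t).
Proof.
move=> Ku At; have [n [phi [phi1 [phi2 [v [Cphi Vv uE uD _]]]]]] := K_structure Ku.
apply: (@eq_L2 (fun x => \sum_k phi k t * v k x)); first by move=> x Ox; rewrite uE.
by apply: L2_sum => // k; exact: V_h_L2.
Qed.

Lemma K_dtt_L2 u t : Kth u -> A t -> L2 (dtt u t).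
Proof.
move=> Ku At; have [n [phi [phi1 [phi2 [v [Cphi Vv uE uD _]]]]]] := K_structure Ku.
apply: (@eq_L2 (fun x => \sum_k phi2 k t * v k x)).
  by move=> x Ox; rewrite (dtt_sum uD).
by apply: L2_sum => // k; exact: V_h_L2.
Qed.

Lemma K_weak_grad u t : Kth u -> A t -> is_weak_grad Omega (u t) (grad (u t)).
Proof.
move=> Ku At; have [n [phi [phi1 [phi2 [v [Cphi Vv uE uD uG]]]]]] := K_structure Ku.
apply: gradP; split; first exact: K_L2.
by exists (fun x => \sum_k phi k t *: grad (v k) x); exact: uG.
Qed.

Lemma grad_lin c u v t : Kth u -> Kth v -> A t ->
  {ae leb, forall x, Omega x -> grad ((c *: u + v) t) x = c *: grad (u t) x + grad (v t) x}.
Proof.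
move=> Ku Kv At.
apply: (@gradE _ _ _ oO bO _ (fun x => c * u t x + v t x)); first exact: aeW.
by apply: weak_grad_lin => //; by [exact: K_L2 | exact: K_weak_grad].
Qed.

Lemma L2ipV_sum (g h : 'rV[R]_d -> 'rV[R]_d) :
  (forall i, L2 (fun x => g x ord0 i)) -> (forall i, L2 (fun x => h x ord0 i)) ->
  L2ipV g h = \sum_i L2ip (fun x => g x ord0 i) (fun x => h x ord0 i).
Proof.
by move=> Lg Lh; rewrite -Rint_sum// => i; exact: ae_int_L2.
Qed.

Lemma eq_L2ipV (g g' h h' : 'rV[R]_d -> 'rV[R]_d) :
  {ae leb, forall x, Omega x -> g x = g' x} -> {ae leb, forall x, Omega x -> h x = h' x} ->
  L2ipV g h = L2ipV g' h'.
Proof.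
move=> gg hh; apply: ae_eq_lower_Rintegral.
by apply: filterS2 gg hh => x h1 h2 Ox; rewrite h1// h2.
Qed.

Lemma L2ipV_lin c (g1 g2 h : 'rV[R]_d -> 'rV[R]_d) :
  (forall i, L2 (fun x => g1 x ord0 i)) -> (forall i, L2 (fun x => g2 x ord0 i)) ->
  (forall i, L2 (fun x => h x ord0 i)) ->
  L2ipV (fun x => c *: g1 x + g2 x) h = c * L2ipV g1 h + L2ipV g2 h.
Proof.
move=> L1 L2' Lh.
rewrite !L2ipV_sum//; last by move=> i; under eq_fun do rewrite !mxE; exact: L2_lin.
rewrite mulr_sumr -big_split /=; apply: eq_bigr => i _.
by rewrite -L2ip_lin//; apply: eq_Rintegral => x _; rewrite !mxE.
Qed.

Lemma L2ipVC (g h : 'rV[R]_d -> 'rV[R]_d) : L2ipV g h = L2ipV h g.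
Proof. by apply: eq_Rintegral => x _; apply: eq_bigr => i _; rewrite mulrC. Qed.

Lemma eq_L2ip (u u' v v' : 'rV[R]_d -> R) :
  {ae leb, forall x, Omega x -> u x = u' x} -> {ae leb, forall x, Omega x -> v x = v' x} ->
  L2ip u v = L2ip u' v'.
Proof.
move=> uu vv; apply: ae_eq_lower_Rintegral.
by apply: filterS2 uu vv => x h1 h2 Ox; rewrite h1// h2.
Qed.

(** The form taken by the integrands of A when both arguments are expanded as
    sums of tensors, G being a Gram matrix of functions of x. *)
Lemma ae_int_gram n1 n2 (a : 'I_n1 -> R -> R) (b : 'I_n2 -> R -> R) (G : 'I_n1 -> 'I_n2 -> R) :
  (forall k, {within A, continuous (a k)}) -> (forall k, {within A, continuous (b k)}) ->
  ae_int lam D (fun t => \sum_k a k t * \sum_l b l t * G k l).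
Proof.
move=> ca cb; apply: ae_int_sum => [|k]; first exact: measurable_itv.
apply: ae_int_continuous_mul => //.
apply: ae_int_sum => [|l]; first exact: measurable_itv.
apply: ae_int_continuous_mul => //; apply: ae_int_continuous => //.
by apply: continuous_subspaceT => t; exact: cst_continuous.
Qed.

Lemma ae_int_dtt u w : Kth u -> Kth w -> ae_int lam D (fun t => L2ip (dtt u t) (dtt w t)).
Proof.
move=> Ku Kw; have [n [phi [phi1 [phi2 [v [Cphi Vv uE uD uG]]]]]] := K_structure Ku.
have [n' [phi' [phi1' [phi2' [v' [Cphi' Vv' uE' uD' uG']]]]]] := K_structure Kw.
apply: (@eq_ae_int _ _ _ lam D (fun t => \sum_k phi2 k t * \sum_l phi2' l t * L2ip (v k) (v' l))).
  apply: aeW => t Dt; have At := subset_oo_cc Dt.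
  have Lv k := V_h_L2 (Vv k); have Lv' k := V_h_L2 (Vv' k).
  transitivity (L2ip (fun x => \sum_k phi2 k t * v k x) (fun x => \sum_k phi2' k t * v' k x)).
    rewrite L2ip_sum//; last exact: L2_sum.
    apply: eq_bigr => k _; congr (_ * _); rewrite L2ipC L2ip_sum//.
    by apply: eq_bigr => l _; rewrite L2ipC.
  apply: eq_L2ip; apply: aeW => x Ox; first by rewrite (dtt_sum uD).
  by rewrite (dtt_sum uD').
by apply: ae_int_gram => k; [have [] := Cphi k | have [] := Cphi' k].
Qed.

Lemma ae_int_grad u w : Kth u -> Kth w -> ae_int lam D (fun t => L2ipV (grad (u t)) (grad (w t))).
Proof.
move=> Ku Kw; have [n [phi [phi1 [phi2 [v [Cphi Vv uE uD uG]]]]]] := K_structure Ku.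
have [n' [phi' [phi1' [phi2' [v' [Cphi' Vv' uE' uD' uG']]]]]] := K_structure Kw.
apply: (@eq_ae_int _ _ _ lam D (fun t =>
    \sum_k phi k t * \sum_l phi' l t * L2ipV (grad (v k)) (grad (v' l)))).
  apply: aeW => t Dt; have At := subset_oo_cc Dt.
  have Lg k i : L2 (fun x => grad (v k) x ord0 i).
    by have [[H _] _] := Vv k; have [] := gradP H.
  have Lg' k i : L2 (fun x => grad (v' k) x ord0 i).
    by have [[H _] _] := Vv' k; have [] := gradP H.
  transitivity (L2ipV (fun x => \sum_k phi k t *: grad (v k) x)
    (fun x => \sum_k phi' k t *: grad (v' k) x)).
    have sE k' (q : 'I_k' -> R) (g : 'I_k' -> 'rV[R]_d -> 'rV[R]_d) i :
      (fun x => (\sum_k q k *: g k x) ord0 i) = fun x => \sum_k q k * g k x ord0 i.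
      by apply/funext => x; rewrite summxE; apply: eq_bigr => k _; rewrite mxE.
    rewrite L2ipV_sum; last 2 first.
      by move=> i; rewrite sE; exact: L2_sum.
      by move=> i; rewrite sE; exact: L2_sum.
    under [RHS]eq_bigr => i _.
      rewrite !sE L2ip_sum//; last exact: L2_sum.
      under eq_bigr => k _.
        rewrite L2ipC L2ip_sum//.
        under eq_bigr do rewrite L2ipC.
        over.
      over.
    rewrite [RHS]exchange_big /=; apply: eq_bigr => k _.
    rewrite -mulr_sumr; congr (_ * _); rewrite exchange_big /=; apply: eq_bigr => l _.
    by rewrite -mulr_sumr L2ipV_sum.
  apply: eq_L2ipV.
    have := weak_grad_unique oO bO (uG t At) (K_weak_grad Ku At); exact.
  have := weak_grad_unique oO bO (uG' t At) (K_weak_grad Kw At); exact.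
by apply: ae_int_gram => k; exact: C2_data_continuous.
Qed.

Lemma ae_int_f u : Kth u -> ae_int lam D (fun t => L2ip (f t) (u t)).
Proof.
move=> Ku; have [n [phi [phi1 [phi2 [v [Cphi Vv uE uD uG]]]]]] := K_structure Ku.
have Lf t : D t -> L2 (f t) by have [h _ _] := hf; rewrite /= in_itv/=; exact: h.
have Lv k := V_h_L2 (Vv k).
apply: (@eq_ae_int _ _ _ lam D (fun t => \sum_k phi k t * L2ip (f t) (v k))).
  apply: aeW => t Dt; have At := subset_oo_cc Dt.
  under eq_bigr do rewrite L2ipC.
  rewrite -L2ip_sum//; last exact: Lf.
  by rewrite L2ipC; apply: eq_L2ip; apply: aeW => x Ox //; rewrite uE.
apply: ae_int_sum => [|k]; first exact: measurable_itv.
apply: ae_int_continuous_mul => //.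
  exact: C2_data_continuous (Cphi k).
exact: bochner_ae_int.
Qed.

Lemma K_st_bounded u : Kth u -> st_bounded Omega T u.
Proof.
move=> Ku; have [n [phi [phi1 [phi2 [v [Cphi Vv uE uD uG]]]]]] := K_structure Ku.
apply: (@eq_st_bounded _ _ _ _ (fun t x => \sum_k phi k t * v k x)).
  by move=> t /subset_oo_cc At; apply: aeW => x Ox; rewrite uE.
apply: st_bounded_tensor => // k; first exact: C2_data_continuous.
  by have [] := V_h_L2 (Vv k).
exact: V_h_bounded cover _ (Vv k).
Qed.

Let form_A := form_A Omega T eps.
Let form_f := form_f Omega T eps f.

Lemma ae_int_A u w : Kth u -> Kth w -> ae_int lam D (fun t =>
  eps ^+ 2 * L2ip (dtt u t) (dtt w t) + L2ipV (grad (u t)) (grad (w t))).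
Proof.
move=> Ku Kw; apply: ae_int_lin; first exact: measurable_itv.
  exact: ae_int_dtt.
exact: ae_int_grad.
Qed.

Lemma form_AC u v : form_A u v = form_A v u.
Proof.
by apply: eq_Rintegral => t _; rewrite L2ipC L2ipVC.
Qed.

Lemma form_A_lin c u v w : Kth u -> Kth v -> Kth w ->
  form_A (c *: u + v) w = c * form_A u w + form_A v w.
Proof.
have aux (q a1 a2 g1 g2 : R) :
  q * (c * a1 + a2) + (c * g1 + g2) = c * (q * a1 + g1) + (q * a2 + g2) by ring.
move=> Ku Kv Kw; rewrite /form_A /Defs.form_A -wint_lin//; try exact: ae_int_A.
apply: eq_wint; apply: aeW => t Dt; have At := subset_oo_cc Dt.
have -> : L2ip (dtt (c *: u + v) t) (dtt w t) =
    c * L2ip (dtt u t) (dtt w t) + L2ip (dtt v t) (dtt w t).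
  rewrite -L2ip_lin//; try exact: K_dtt_L2.
  by apply: eq_L2ip; apply: aeW => x Ox //; rewrite dtt_lin.
have -> : L2ipV (grad ((c *: u + v) t)) (grad (w t)) =
    c * L2ipV (grad (u t)) (grad (w t)) + L2ipV (grad (v t)) (grad (w t)).
  rewrite -L2ipV_lin; [|by have [] := K_weak_grad Ku At|by have [] := K_weak_grad Kv At|
    by have [] := K_weak_grad Kw At].
  by apply: eq_L2ipV; [exact: grad_lin | exact: aeW].
exact: aux.
Qed.

Lemma L2ipV_ge0 (g : 'rV[R]_d -> 'rV[R]_d) : 0 <= L2ipV g g.
Proof.
by apply: Rintegral_ge0 => x _; apply: sumr_ge0 => i _; rewrite -expr2 sqr_ge0.
Qed.

Lemma A_integrand_ge0 u t :
  0 <= eps ^+ 2 * L2ip (dtt u t) (dtt u t) + L2ipV (grad (u t)) (grad (u t)).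
Proof. by rewrite addr_ge0 ?L2ipV_ge0// mulr_ge0 ?sqr_ge0// L2ip_ge0. Qed.

Lemma form_A_ge0 u : 0 <= form_A u u.
Proof. by apply: wint_ge0 => t _; exact: A_integrand_ge0. Qed.

(** Pairing with a fixed function of x turns an element of the space into a C^2
    function of time with zero initial data. *)
Lemma K_test u g : Kth u -> L2 g -> exists psi psi1 psi2,
  C2_data psi psi1 psi2 /\ forall t, A t -> psi t = L2ip (u t) g /\ psi2 t = L2ip (dtt u t) g.
Proof.
move=> Ku Lg; have [n [phi [phi1 [phi2 [v [Cphi Vv uE uD uG]]]]]] := K_structure Ku.
have Lv k := V_h_L2 (Vv k).
exists (fun t => \sum_k phi k t * L2ip (v k) g), (fun t => \sum_k phi1 k t * L2ip (v k) g),
  (fun t => \sum_k phi2 k t * L2ip (v k) g); split.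
- split.
  + by move=> x Ax; apply: is_derive_within_sum => k; have [h _ _ _ _] := Cphi k; exact: h.
  + by move=> x Ax; apply: is_derive_within_sum => k; have [_ h _ _ _] := Cphi k; exact: h.
  + elim: (index_enum _) => [|k l IH].
      rewrite (_ : (fun t => _) = cst 0); last by apply/funext => t; rewrite big_nil.
      by apply: continuous_subspaceT => t; exact: cst_continuous.
    rewrite (_ : (fun t => _) = (fun t => phi2 k t * L2ip (v k) g
        + \sum_(i <- l) phi2 i t * L2ip (v i) g)); last by apply/funext => t; rewrite big_cons.
    have h1 : {within A, continuous (fun t => phi2 k t * L2ip (v k) g)}.
      have hc : {within A, continuous (fun _ : R => L2ip (v k) g)}.
        by apply: continuous_subspaceT => t; exact: cst_continuous.
      have [_ _ h _ _] := Cphi k.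
      by move=> x; exact: (continuousM (h x) (hc x)).
    by move=> x; exact: (continuousD (h1 x) (IH x)).
  + by rewrite big1// => k _; have [_ _ _ -> _] := Cphi k; rewrite mul0r.
  + by rewrite big1// => k _; have [_ _ _ _ ->] := Cphi k; rewrite mul0r.
move=> t At; rewrite -!L2ip_sum//; split; apply: eq_L2ip; apply: aeW => x Ox //.
  by rewrite uE.
by rewrite (dtt_sum uD).
Qed.

Lemma L2ip_null (u g : 'rV[R]_d -> R) : L2 u -> L2 g -> L2ip u u = 0 -> L2ip u g = 0.
Proof.
move=> Lu Lg u0; have := L2ip_cauchy_schwarz mO Lu Lg.
rewrite u0 mul0r => h; apply/eqP; rewrite -sqrf_eq0 eq_le h sqr_ge0 //.
Qed.

(** The second time derivative of z is null at almost every time. Paired with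
    z t0, it is continuous in time, hence zero at every time; thus the pairing
    of z with z t0 has zero second derivative and zero initial data, and
    vanishes at t0. *)
Lemma form_A_null z : Kth z -> form_A z z = 0 ->
  forall t, A t -> {ae leb, forall x, Omega x -> z t x = 0}.
Proof.
move=> Kz z0 t0 At0.
have h : {ae lam, forall t, D t -> L2ip (dtt z t) (dtt z t) = 0}.
  have := wint_eq0 (ae_int_A Kz Kz) (fun t _ => A_integrand_ge0 z t) z0.
  apply: ae_lamS => t h /h /eqP.
  have q1 : 0 <= eps ^+ 2 * L2ip (dtt z t) (dtt z t).
    by rewrite mulr_ge0 ?sqr_ge0// L2ip_ge0.
  rewrite (paddr_eq0 q1 (L2ipV_ge0 _)) => /andP[+ _].
  by rewrite mulf_eq0 sqrf_eq0 gt_eqF//= => /eqP.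
have Lz := K_L2 Kz At0.
have [psi [psi1 [psi2 [[d1 d2 c2 p0 p1] pE]]]] := K_test Kz Lz.
have psi20 : forall t, D t -> psi2 t = 0.
  apply: continuous_ae0 => //; apply: ae_lamS h => t h Dt.
  have At := subset_oo_cc Dt; have [_ ->] := pE _ At.
  by apply: L2ip_null => //; [exact: K_dtt_L2 | exact: h].
have := pE _ At0; rewrite (derive_within2_eq0 d1 d2 _ p0 p1 At0); last first.
  by move=> x xT; apply: psi20; rewrite /= in_itv.
by case=> /esym e _; exact: L2ip_eq0.
Qed.

(** The null set of x depends on t, so the time derivatives of w cannot be taken
    pointwise in x; they are taken after pairing with the second time derivative
    of w at a fixed time. *)
Lemma K_ae0_A w : Kth w ->
  (forall t, 0 < t <= T -> {ae leb, forall x, Omega x -> w t x = 0}) -> form_A w w = 0.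
Proof.
move=> Kw w0; rewrite -(@wint0 _ T eps); apply: eq_wint; apply: aeW => t Dt.
have At := subset_oo_cc Dt.
have tT : 0 < t <= T by move: Dt; rewrite /= in_itv/= => /andP[-> /ltW ->].
have cst0 : L2ipV (cst 0) (cst 0) = 0.
  by rewrite L2ipV_sum ?big1// => i; under eq_fun do rewrite mxE; try exact: L2_0;
    rewrite /Defs.L2ip; under eq_Rintegral do rewrite mul0r; rewrite Rintegral_cst// mul0r.
have -> : L2ipV (grad (w t)) (grad (w t)) = 0.
  rewrite -cst0; have g0 := gradE oO bO (w0 t tT) (weak_grad0 oO).
  exact: eq_L2ipV.
have [psi [psi1 [psi2 [[d1 d2 c2 p0 p1] pE]]]] := K_test Kw (K_dtt_L2 Kw At).
have psi0 y : A y -> psi y = 0.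
  move=> Ay; have [->//|yn0] := eqVneq y 0.
  have y0 : 0 < y <= T by move: Ay; rewrite /= in_itv/= lt_def yn0.
  have [-> _] := pE _ Ay; rewrite (@eq_L2ip _ (cst 0) _ (dtt w t)).
  - by rewrite /Defs.L2ip; under eq_Rintegral do rewrite mul0r; rewrite Rintegral_cst// mul0r.
  - exact: w0.
  - exact: aeW.
have zero_dw y : is_derive_within T (cst 0) y 0 by exact: is_derive_within_cst.
have e1 y : A y -> psi1 y = 0.
  move=> Ay; rewrite -(is_derive_withinE T0 Ay (d1 y Ay)).
  apply: is_derive_withinE => //.
  by apply: eq_is_derive_within (zero_dw y) => // z Az; rewrite psi0.
have e2 : psi2 t = 0.
  rewrite -(is_derive_withinE T0 At (d2 t At)).
  by apply: is_derive_withinE => //; apply: eq_is_derive_within (zero_dw t) => // z Az; rewrite e1.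
by have [_ <-] := pE _ At; rewrite e2 mulr0 addr0.
Qed.

Lemma form_f_lin c u v : Kth u -> Kth v -> form_f (c *: u + v) = c * form_f u + form_f v.
Proof.
move=> Ku Kv; rewrite /form_f /Defs.form_f -wint_lin//; try exact: ae_int_f.
apply: eq_wint; apply: aeW => t Dt; have At := subset_oo_cc Dt.
have Lf : L2 (f t) by have [h _ _] := hf; move: Dt; rewrite /= in_itv/=; exact: h.
rewrite L2ipC (L2ipC _ (f t) (u t)) (L2ipC _ (f t) (v t)).
have := L2ip_lin mO c (K_L2 Ku At) (K_L2 Kv At) Lf; exact.
Qed.

(* the convex part of the functional and its directional derivative, which is
   twice form_B *)
Let P u := wint (fun t => Lp_term Omega p (u t)).
Let b u v := p * wint (fun t => L2ip (fun x => psi p (u t x)) (v t)).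

Lemma K_lin c u v : Kth u -> Kth v -> Kth (c *: u + v).
Proof. exact: K_tau_h_lin. Qed.

Lemma st_bounded_power u : 2 <= p -> Kth u -> st_bounded Omega T (fun t x => `|u t x| `^ p).
Proof.
move=> p2 Ku.
apply: (@st_bounded_comp2 _ _ _ _ (fun x _ => `|x| `^ p) u u (fun M => M `^ p)).
- exact: K_st_bounded.
- exact: K_st_bounded.
- apply: (measurableT_comp (measurable_powR p)); apply: measurableT_comp => //.
- move=> M x y M0 xM _; rewrite ger0_norm ?powR_ge0// ge0_ler_powR ?nnegrE//; lra.
Qed.

Lemma st_bounded_psi u v : 2 <= p -> Kth u -> Kth v ->
  st_bounded Omega T (fun t x => psi p (u t x) * v t x).
Proof.
move=> p2 Ku Kv.
apply: (@st_bounded_comp2 _ _ _ _ (fun x y => psi p x * y) u v (fun M => M `^ (p - 1) * M)).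
- exact: K_st_bounded.
- exact: K_st_bounded.
- apply: measurable_funM => //; rewrite /psi; apply: measurable_funM => //.
  by apply: (measurableT_comp (measurable_powR _)); apply: measurableT_comp.
- move=> M x y M0 xM yM; rewrite normrM norm_psi// ler_pM// ?powR_ge0//.
  by rewrite ge0_ler_powR ?nnegrE//; lra.
Qed.

Lemma ae_int_P u : Kth u -> ae_int lam D (fun t => Lp_term Omega p (u t)).
Proof.
move=> Ku; rewrite /Lp_term; case: eqP => [_|p0].
  by apply: ae_int0; exact: measurable_itv.
have p2 : 2 <= p by case: p_val => // /p0.
exact: st_bounded_time (st_bounded_power p2 Ku).
Qed.

Lemma b_lin c u v w : Kth u -> Kth v -> Kth w -> b w (c *: u + v) = c * b w u + b w v.
Proof.
move=> Ku Kv Kw; rewrite /b; case: p_val => [p0|p2].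
  by rewrite p0 (mul0r (wint _)) (mul0r (wint _)) (mul0r (wint _)) mulr0 addr0.
rewrite mulrCA -mulrDr; congr (_ * _).
have iu := st_bounded_time oO bO T0 (st_bounded_psi p2 Kw Ku).
have iv := st_bounded_time oO bO T0 (st_bounded_psi p2 Kw Kv).
rewrite -(wint_lin eps c iu iv).
apply: eq_wint; apply: aeW => t Dt.
rewrite -Rint_lin//; [|exact: st_bounded_space (st_bounded_psi p2 Kw Ku) Dt
  |exact: st_bounded_space (st_bounded_psi p2 Kw Kv) Dt].
by apply: eq_Rintegral => x _; rewrite !fctE /GRing.scale /=; ring.
Qed.

Lemma K_sub u v : Kth u -> Kth v -> Kth (v - u).
Proof. by move=> Ku Kv; rewrite addrC -scaleN1r; exact: K_lin. Qed.

Lemma P_subgradient u v : Kth u -> Kth v -> P u + b u (v - u) <= P v.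
Proof.
move=> Ku Kv; rewrite /P /b; case: p_val => [p0|p2].
  by rewrite /Lp_term p0 eqxx mul0r addr0.
have iP := ae_int_P Ku; have iP' := ae_int_P Kv.
have sb := st_bounded_psi p2 Ku (K_sub Ku Kv).
have ib := st_bounded_time oO bO T0 sb.
have il := @ae_int_lin _ _ _ lam D (measurable_itv _) p _ _ ib iP.
rewrite addrC -(wint_lin eps p ib iP); apply: (wint_le eps il iP') => t Dt.
rewrite /Lp_term gt_eqF; last by lra.
have su := st_bounded_space oO bO (st_bounded_power p2 Ku) Dt.
have sv := st_bounded_space oO bO (st_bounded_power p2 Kv) Dt.
have sb' := st_bounded_space oO bO sb Dt.
have sl := ae_int_lin mO p sb' su.
rewrite -(Rint_lin mO p sb' su); apply: (Rint_le mO sl sv).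
by apply: aeW => x Ox; rewrite addrC; exact: psi_subgradient.
Qed.

(** [psi_increment], integrated over space and time; C is uniform because u and v
    are bounded. *)
Lemma b_increment u v : Kth u -> Kth v -> exists C : R, forall c : R, 0 < c <= 1 ->
  b (u + c *: v) v <= b u v + C * c.
Proof.
move=> Ku Kv; rewrite /b; case: p_val => [p0|p2].
  by exists 0 => c _; rewrite p0 (mul0r (wint _)) (mul0r (wint _)) (mul0r c) addr0.
have [M1 [M10 uM]] := st_bounded_bound (K_st_bounded Ku).
have [M2 [M20 vM]] := st_bounded_bound (K_st_bounded Kv).
pose M := M1 + M2.
pose C := (p - 1) * (2 * M) `^ (p - 2) * M ^+ 2.
have sb := st_bounded_psi p2 Ku Kv.
have ib := st_bounded_time oO bO T0 sb.
have i1 : ae_int lam D (cst (\int[leb]_(x in Omega) C)).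
  by apply: ae_int_continuous => //; apply: continuous_subspaceT => t; exact: cst_continuous.
exists (p * wint (cst (\int[leb]_(x in Omega) C))) => c c01.
have Kuv : Kth (u + c *: v) by rewrite addrC; exact: K_lin.
have sbc := st_bounded_psi p2 Kuv Kv.
have ibc := st_bounded_time oO bO T0 sbc.
have il := @ae_int_lin _ _ _ lam D (measurable_itv _) c _ _ i1 ib.
rewrite -mulrA -mulrDr ler_wpM2l//; first by lra.
rewrite [leRHS]addrC [X in _ <= X + _]mulrC -(wint_lin eps c i1 ib).
apply: (wint_le eps ibc il) => t Dt.
have su := st_bounded_space oO bO sb Dt; have suv := st_bounded_space oO bO sbc Dt.
have sC : ae_int leb Omega (cst C).
  apply: (@ae_int_bounded _ _ _ leb Omega mO (cst C) `|C| fO) => //.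
  exact: aeW.
have sl := ae_int_lin mO c sC su.
rewrite -(Rint_lin mO c sC su); apply: (Rint_le mO suv sl).
have incr (x y : R) : `|x| <= M -> `|y| <= M ->
    psi p (x + c * y) * y <= c * C + psi p x * y.
  by move=> xM yM; rewrite (addrC (c * C)) (mulrC c C); exact: (psi_increment p2 xM yM c01).
apply: filterS2 (uM t Dt) (vM t Dt) => x ux vx Ox; apply: incr.
  by apply: le_trans (ux Ox) _; rewrite lerDl.
by apply: le_trans (vx Ox) _; rewrite lerDr.
Qed.

Lemma functionalE u : Kth u ->
  wide_functional Omega T eps p f u = energy form_A form_f P u.
Proof.
move=> Ku.
have iA := ae_int_A Ku Ku; have iP := ae_int_P Ku; have jf := ae_int_f Ku.
have iAP : ae_int lam D (fun t =>
    (eps ^+ 2 * L2ip (dtt u t) (dtt u t) + L2ipV (grad (u t)) (grad (u t)))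
    + Lp_term Omega p (u t)).
  by apply: ae_intD => //; exact: measurable_itv.
rewrite /energy /form_A /form_f /P -wintD// addrC -mulNr -wint_lin//.
by apply: eq_wint; apply: aeW => t _; rewrite addrC mulNr.
Qed.

Lemma null_forms z : Kth z -> form_A z z = 0 ->
  form_f z = 0 /\ forall u, Kth u -> b u z = 0.
Proof.
move=> Kz /(form_A_null Kz) h.
have R0 : \int[leb]_(x in Omega) 0 = 0 :> R by rewrite Rintegral_cst// mul0r.
split.
  rewrite -(wint0 T eps); apply: eq_wint; apply: aeW => t /subset_oo_cc At.
  rewrite /Defs.L2ip -[RHS]R0; apply: ae_eq_lower_Rintegral.
  by apply: filterS (h t At) => x e Ox; rewrite e// mulr0.
move=> u Ku; rewrite /b -[RHS](mulr0 p); congr (_ * _).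
rewrite -(wint0 T eps); apply: eq_wint; apply: aeW => t /subset_oo_cc At.
rewrite /Defs.L2ip -[RHS]R0; apply: ae_eq_lower_Rintegral.
by apply: filterS (h t At) => x e Ox; rewrite e// mulr0.
Qed.

Hypothesis htau : time_mesh T Nt tau.

Lemma discrete_minimisation : exists u, [/\ is_minimiser Kth (wide_functional Omega T eps p f) u,
  (forall w, is_minimiser Kth (wide_functional Omega T eps p f) w -> forall t, A t ->
     {ae leb, forall x, Omega x -> w t x = u t x}) &
  forall v, Kth v -> form_A u v + form_B Omega T eps p u v = form_f v].
Proof.
have Kz : Kth 0 by exact: K_tau_h0.
have Klin c u v : Kth u -> Kth v -> Kth (c *: u + v) by exact: K_lin.
have dep (e : 'I_#|{: 'I_Nt * 'I_r.+3 * ('I_m * {ffun 'I_d -> 'I_s.+1})}|.+1 ->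
    R -> 'rV[R]_d -> R) : (forall i, Kth (e i)) ->
    exists c, (exists i, c i != 0) /\
      form_A (\sum_i c i *: e i) (\sum_i c i *: e i) = 0.
  move=> Ke; have [c [c0 cz]] := K_dependent cover htau Ke; exists c; split => //.
  by apply: K_ae0_A => //; exact: (@subspace_sum _ _ Kth Kz Klin).
have [u [Ku umin]] := exists_energy_min Kz Klin form_AC form_A_lin b_lin form_f_lin
  (fun u _ => form_A_ge0 u) P_subgradient dep null_forms.
have EL := euler_lagrange Kz Klin form_AC form_A_lin b_lin form_f_lin
  (fun u _ => form_A_ge0 u) P_subgradient Ku umin (fun v Kv => b_increment Ku Kv).
exists u; split.
- by split => // w Kw; rewrite !functionalE//; exact: umin.
- move=> w [Kw wmin] t At.
  have wmin' v : Kth v -> energy form_A form_f P w <= energy form_A form_f P v.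
    by move=> Kv; rewrite -!functionalE//; exact: wmin.
  have := energy_min_unique Klin form_AC form_A_lin form_f_lin
    (fun u _ => form_A_ge0 u) P_subgradient Ku Kw EL wmin'.
  move=> /(form_A_null (K_sub Ku Kw)) /(_ t At).
  by apply: filterS => x h /h /eqP; rewrite !fctE subr_eq0 => /eqP.
- move=> v Kv; have := EL v Kv; rewrite /b /form_B.
  have -> : wint (fun t => L2ip (fun x => `|u t x| `^ (p - 2) * u t x) (v t)) =
    wint (fun t => L2ip (fun x => psi p (u t x)) (v t)) by [].
  set X := wint _; lra.
Qed.

End forms_on_K.

Theorem mainTheorem2
  (R : realType) (d : nat) (hd : (1 <= d <= 3)%N)
  (Omega : set 'rV[R]_d) (hOmega : polyhedral_domain Omega)
  (T : R) (hT : 0 < T) (eps : R) (heps : 0 < eps)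
  (p : R) (hp : p = 0 \/ p = 2 \/ 2 < p)
  (f : R -> 'rV[R]_d -> R) (hf : bochner_L2 Omega T f)
  (Nt : nat) (tau : nat -> R) (htau : time_mesh T Nt tau)
  (r : nat) (hr : (1 <= r)%N)
  (sigma : R) (m : nat) (K : 'I_m -> set 'rV[R]_d)
  (hK : shape_regular_mesh Omega sigma K)
  (s : nat) (hs : (1 <= s)%N) :
  let Kth := K_tau_h Omega T Nt tau r K s in
  let I_eps := wide_functional Omega T eps p f in
  exists u : R -> 'rV[R]_d -> R,
    [/\ is_minimiser Kth I_eps u,
        (forall w, is_minimiser Kth I_eps w ->
          forall t, 0 <= t <= T ->
            {ae (@lebesgue_rV R d), forall x, Omega x -> w t x = u t x}) &
        (forall v, Kth v ->
          form_A Omega T eps u v + form_B Omega T eps p u v =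
          form_f Omega T eps f v)].
Proof.
move=> Kth I_eps.
have [oO _ _ bO _] := hOmega.
have [_ cover _ _ _] := hK.
have p_val : p = 0 \/ 2 <= p.
  by case: hp => [->|[->|/ltW p2]]; [left | right | right].
have [u [umin uniq EL]] :=
  discrete_minimisation oO bO hT heps p_val hf s cover r htau.
by exists u; split => // w wmin t tT; apply: uniq wmin t _; rewrite /= in_itv.
Qed.
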